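(* Every Banach space has the local MAP for $\mathcal I_p$, for every $1\le p\le\infty$.
   Context: All Banach spaces are over the same field, real or complex. $\mathcal I_p$ ($1\le p\le\infty$) is the Banach operator ideal of $p$-integral operators: the maximal Banach operator ideal associated with the Chevet–Saphar tensor norm $g_p$. Concretely, $T\in\mathcal I_p(X;Y)$ iff there are a probability measure $\mu$ and bounded operators $A\colon X\to L_\infty(\mu)$, $B\colon L_p(\mu)\to Y^{**}$ with $J_YT=B\,i_p\,A$, where $i_p\colon L_\infty(\mu)\to L_p(\mu)$ is the canonical map and $J_Y\colon Y\to Y^{**}$ is the canonical inclusion (for $p=\infty$: $J_YT=BA$ factors through some $L_\infty(\mu)$, equivalently through some $C(K)$-space); the norm is $\|T\|_{\mathcal I_p}=\inf\|A\|\,\|B\|$. For a Banach operator ideal $(\mathcal A,\|\cdot\|_{\mathcal A})$, $X$ has the local MAP for $\mathcal A$ if for every Banach space $Y$ and each $T\in\mathcal A(X;Y)$ there is a net $(T_\alpha)$ of finite rank operators from $X$ to $Y$ such that $T_\alpha\to T$ pointwise and $\limsup_\alpha\|T_\alpha\|_{\mathcal A}\le\|T\|_{\mathcal A}$. *)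

(* Defs.v *)
From HB Require Import structures.
From mathcomp Require Import all_boot all_order all_algebra.
From mathcomp Require Import complex.
From mathcomp Require Import all_classical all_reals all_analysis.

Set Implicit Arguments.
Unset Strict Implicit.
Unset Printing Implicit Defensive.

Import Order.TTheory GRing.Theory Num.Theory.
Import numFieldNormedType.Exports.

Local Open Scope classical_set_scope.
Local Open Scope ring_scope.

(** * Scalars: the real field [R] or the complex field [R[i]] *)

Inductive scalars := RealScalars | ComplexScalars.

Definition scalar_field (R : realType) (s : scalars) : numFieldType :=
  match s with
  | RealScalars => R : numFieldType
  | ComplexScalars => R[i] : numFieldType
  end.

Section Scalars.
Context (R : realType) (s : scalars).
Local Notation K := (scalar_field R s).

Definition scalar_re : K -> R :=
  match s return scalar_field R s -> R with
  | RealScalars => id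
  | ComplexScalars => @complex.Re R
  end.

Definition scalar_im : K -> R :=
  match s return scalar_field R s -> R with
  | RealScalars => fun=> 0
  | ComplexScalars => @complex.Im R
  end.

Definition scalar_of_real : R -> K :=
  match s return R -> scalar_field R s with
  | RealScalars => id
  | ComplexScalars => fun r => r%:C%C
  end.

Definition modulus (k : K) : R := scalar_re `|k|.

(* The norm of a normedModType over K takes values in K; [rnorm] is the same
   norm read as an element of [R]. *)
Definition rnorm (E : normedModType K) (x : E) : R := scalar_re `|x|.

End Scalars.

Arguments scalar_re {R s}.
Arguments scalar_im {R s}.
Arguments scalar_of_real {R} s.
Arguments modulus {R s} k.
Arguments rnorm {R s E} x.

Section ScalarsTheory.
Context (R : realType) (s : scalars).
Local Notation K := (scalar_field R s).

Lemma scalar_of_realD (a b : R) :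
  scalar_of_real s (a + b) = scalar_of_real s a + scalar_of_real s b.
Proof. by rewrite /scalar_of_real; case: s => //=; rewrite rmorphD. Qed.

Lemma scalar_of_realM (a b : R) :
  scalar_of_real s (a * b) = scalar_of_real s a * scalar_of_real s b.
Proof. by rewrite /scalar_of_real; case: s => //=; rewrite rmorphM. Qed.

Lemma ler_scalar_of_real (a b : R) :
  (scalar_of_real s a <= scalar_of_real s b) = (a <= b).
Proof. by rewrite /scalar_of_real; case: s => //=; rewrite lecR. Qed.

Lemma scalar_of_realK : cancel (@scalar_of_real R s) (@scalar_re R s).
Proof. by rewrite /scalar_of_real /scalar_re; case: s. Qed.

Lemma scalar_of_real_inj : injective (@scalar_of_real R s).
Proof. exact: can_inj scalar_of_realK. Qed.

Lemma scalar_of_real0 : @scalar_of_real R s 0 = 0.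
Proof. by rewrite /scalar_of_real; case: s. Qed.

Lemma scalar_reK (k : K) : k \is Num.real -> scalar_of_real s (scalar_re k) = k.
Proof.
by move: k; rewrite /scalar_of_real /scalar_re; case: s => //= k /RRe_real.
Qed.

Lemma modulusE (k : K) : scalar_of_real s (modulus k) = `|k|.
Proof. by rewrite /modulus scalar_reK// normr_real. Qed.

Lemma modulus_ge0 (k : K) : 0 <= modulus k.
Proof. by rewrite -ler_scalar_of_real modulusE scalar_of_real0. Qed.

Lemma modulusD (k l : K) : modulus (k + l) <= modulus k + modulus l.
Proof. by rewrite -ler_scalar_of_real scalar_of_realD !modulusE ler_normD. Qed.

Lemma modulusM (k l : K) : modulus (k * l) = modulus k * modulus l.
Proof. by apply: scalar_of_real_inj; rewrite scalar_of_realM !modulusE normrM. Qed.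

Lemma modulus0 : modulus (0 : K) = 0.
Proof. by apply: scalar_of_real_inj; rewrite modulusE normr0 scalar_of_real0. Qed.

Lemma modulus_eq0 (k : K) : modulus k = 0 -> k = 0.
Proof. by move=> k0; apply/normr0_eq0; rewrite -modulusE k0 scalar_of_real0. Qed.

End ScalarsTheory.

Section NormTheory.
Context (R : realType) (s : scalars).
Local Notation K := (scalar_field R s).
Context (E : normedModType K).
Implicit Types x y : E.

Lemma rnormE x : scalar_of_real s (rnorm x) = `|x|.
Proof. by rewrite /rnorm scalar_reK// normr_real. Qed.

Lemma rnorm_ge0 x : 0 <= rnorm x.
Proof. by rewrite -(ler_scalar_of_real s) rnormE scalar_of_real0. Qed.

Lemma rnormD x y : rnorm (x + y) <= rnorm x + rnorm y.
Proof. by rewrite -(ler_scalar_of_real s) scalar_of_realD !rnormE ler_normD. Qed.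

Lemma rnormZ (k : K) x : rnorm (k *: x) = modulus k * rnorm x.
Proof.
apply: (@scalar_of_real_inj R s).
by rewrite scalar_of_realM modulusE !rnormE normrZ.
Qed.

Lemma rnorm_eq0 x : rnorm x = 0 -> x = 0.
Proof. by move=> x0; apply/normr0_eq0; rewrite -rnormE x0 scalar_of_real0. Qed.

Lemma rnorm0 : rnorm (0 : E) = 0.
Proof. by apply: (@scalar_of_real_inj R s); rewrite rnormE normr0 scalar_of_real0. Qed.

End NormTheory.

(** * The topological dual as a normed space, and the canonical inclusion *)

Section Dual.
Context (R : realType) (s : scalars).
Local Notation K := (scalar_field R s).
Context (E : normedModType K).

Definition functional : {pred E -> K^o} :=
  [pred f : E -> K^o | `[< linear f /\ continuous f >]].

Lemma functionalP (f : E -> K^o) :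
  reflect (linear f /\ continuous f) (f \in functional).
Proof. exact: asboolP. Qed.

Lemma functional_submod_closed : submod_closed functional.
Proof.
split=> [|k f g /functionalP[lf cf] /functionalP[lg cg]].
  by apply/functionalP; split=> [k x y|x]; [rewrite scaler0 addr0|exact: cvg_cst].
apply/functionalP; split=> [a x y|x] /=.
  rewrite !fctE lf lg !scalerDr !scalerA -!addrA; congr (_ + _).
    by rewrite mulrC.
  by rewrite addrCA.
by apply: cvgD; [apply: cvgZr; exact: cf|exact: cg].
Qed.

HB.instance Definition _ :=
  GRing.isSubmodClosed.Build _ _ functional functional_submod_closed.

Record dual := Dual { dual_fun :> E -> K^o; dual_funP : dual_fun \in functional }.

HB.instance Definition _ := [isSub for dual_fun].
HB.instance Definition _ := [Choice of dual by <:].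
HB.instance Definition _ := [SubChoice_isSubLmodule of dual by <:].

(* the operator norm of a functional *)
Definition dual_rnorm (f : dual) : R :=
  inf [set c : R | 0 <= c /\ forall x, modulus (f x) <= c * rnorm x].

Lemma dual_linear (f : dual) : linear f.
Proof. by have /functionalP[] := dual_funP f. Qed.

Lemma dual_bounded (f : dual) :
  exists c : R, 0 <= c /\ forall x, modulus (f x) <= c * rnorm x.
Proof.
have /functionalP[lf cf] := dual_funP f.
pose F : {linear E -> K^o} := HB.pack (dual_fun f)
  (GRing.isLinear.Build _ _ _ _ (dual_fun f) lf).
have /linear_boundedP[M [Mr]] : bounded_near F (nbhs 0).
  exact/linear_bounded_continuous.
move=> H.
have M1 : M < `|M| + 1.
  by rewrite (le_lt_trans (real_ler_norm Mr))// ltrDl.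
have M1r : `|M| + 1 \is Num.real by rewrite realD// normr_real.
exists (scalar_re (`|M| + 1)); split.
  by rewrite -(ler_scalar_of_real s) scalar_reK// scalar_of_real0 addr_ge0.
move=> x; rewrite -(ler_scalar_of_real s) scalar_of_realM modulusE rnormE scalar_reK//.
exact: H.
Qed.

Lemma dual_rnorm_ge0 (f : dual) : 0 <= dual_rnorm f.
Proof.
have [c cP] := dual_bounded f.
by apply: lb_le_inf; [exists c|move=> r []].
Qed.

Lemma dual_rnorm_bound (f : dual) x : modulus (f x) <= dual_rnorm f * rnorm x.
Proof.
have [x0|x0] := eqVneq (rnorm x) 0.
  have [c [_ /(_ x)]] := dual_bounded f.
  by rewrite x0 !mulr0.
have xgt0 : 0 < rnorm x by rewrite lt_def x0 rnorm_ge0.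
rewrite -ler_pdivrMr//; have [c cP] := dual_bounded f.
apply: lb_le_inf; first by exists c.
by move=> r [_ /(_ x)]; rewrite ler_pdivrMr.
Qed.

Lemma dual_rnorm_le (f : dual) c :
  0 <= c -> (forall x, modulus (f x) <= c * rnorm x) -> dual_rnorm f <= c.
Proof. by move=> c0 fc; apply: ge_inf; [exists 0 => r []|split]. Qed.

Lemma dual_rnormD (f g : dual) :
  dual_rnorm (f + g) <= dual_rnorm f + dual_rnorm g.
Proof.
apply: dual_rnorm_le => [|x]; first by rewrite addr_ge0// dual_rnorm_ge0.
by rewrite mulrDl (le_trans (modulusD _ _))// lerD// dual_rnorm_bound.
Qed.

Lemma dual_rnormZ (k : K) (f : dual) :
  dual_rnorm (k *: f) = modulus k * dual_rnorm f.
Proof.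
have le_ (l : K) (g : dual) : dual_rnorm (l *: g) <= modulus l * dual_rnorm g.
  apply: dual_rnorm_le => [|x]; first by rewrite mulr_ge0 ?modulus_ge0 ?dual_rnorm_ge0.
  by rewrite modulusM -mulrA ler_wpM2l ?modulus_ge0// dual_rnorm_bound.
apply/eqP; rewrite eq_le le_ /=.
have [->|k0] := eqVneq k 0; first by rewrite modulus0 mul0r dual_rnorm_ge0.
have kgt0 : 0 < modulus k.
  by rewrite lt_def modulus_ge0 andbT; apply: contra_neq k0; exact: modulus_eq0.
rewrite mulrC -ler_pdivlMr// mulrC.
have -> : (modulus k)^-1 = modulus k^-1.
  apply: (mulfI (lt0r_neq0 kgt0)); rewrite mulfV ?gt_eqF// -modulusM mulfV//.
  apply: (@scalar_of_real_inj R s).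
  by rewrite modulusE normr1 /scalar_of_real; case: (s).
by rewrite (le_trans _ (le_ _ _))// scalerA mulVf// scale1r.
Qed.

Definition dual_norm (f : dual) : K := scalar_of_real s (dual_rnorm f).

Lemma ler_dual_normD f g : dual_norm (f + g) <= dual_norm f + dual_norm g.
Proof. by rewrite /dual_norm -scalar_of_realD ler_scalar_of_real dual_rnormD. Qed.

Lemma dual_normZ (k : K) f : dual_norm (k *: f) = `|k| * dual_norm f.
Proof. by rewrite /dual_norm dual_rnormZ scalar_of_realM modulusE. Qed.

Lemma dual_norm_eq0 f : dual_norm f = 0 -> f = 0.
Proof.
move=> f0; have {}f0 : dual_rnorm f = 0.
  by apply: (@scalar_of_real_inj R s); rewrite scalar_of_real0.
apply/val_inj/funext => x; apply: modulus_eq0; apply/eqP.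
by rewrite eq_le modulus_ge0 andbT (le_trans (dual_rnorm_bound f x))// f0 mul0r.
Qed.

HB.instance Definition _ :=
  @Lmodule_isNormed.Build K dual dual_norm ler_dual_normD dual_normZ dual_norm_eq0.

Lemma rnorm_dual (f : dual) : rnorm f = dual_rnorm f.
Proof. exact: scalar_of_realK. Qed.

End Dual.

Arguments dual {R s} E.

Section Bidual.
Context (R : realType) (s : scalars).
Local Notation K := (scalar_field R s).
Context (E : normedModType K).

Lemma evaluation_functional (x : E) :
  (fun f : dual E => f x : K^o) \in @functional R s (dual E).
Proof.
apply/functionalP.
pose ev := fun f : dual E => f x : K^o.
have lev : linear ev by [].
split=> //.
pose F : {linear dual E -> K^o} := HB.pack ev (GRing.isLinear.Build _ _ _ _ ev lev).
apply: (@bounded_linear_continuous _ _ _ F); apply/linear_boundedP.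
exists `|x|; split=> [|r xr f]; first exact: normr_real.
rewrite (le_trans (y := `|x| * `|f|))//; last by rewrite ler_wpM2r// ltW.
rewrite -modulusE -!rnormE -scalar_of_realM ler_scalar_of_real mulrC rnorm_dual.
exact: dual_rnorm_bound.
Qed.

(* J_E : E -> E** *)
Definition canonical_inclusion (x : E) : dual (dual E) :=
  Dual (evaluation_functional x).

End Bidual.

(** * Lebesgue spaces of scalar-valued functions

    Elements of [L_p(mu)] are represented by functions: [in_Lp mu p f] says
    that [f] represents an element, and two functions represent the same
    element iff they are equal [mu]-almost everywhere. *)

Section Lp.
Context (R : realType) (s : scalars).
Local Notation K := (scalar_field R s).
Context d (T : measurableType d) (mu : {measure set T -> \bar R}).

Definition Lp_norm (p : \bar R) (f : T -> K) : \bar R :=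
  Lnorm mu p (fun t => (modulus (f t))%:E).

Definition in_Lp (p : \bar R) (f : T -> K) : Prop :=
  [/\ measurable_fun setT (fun t => scalar_re (f t)),
      measurable_fun setT (fun t => scalar_im (f t)) &
      (Lp_norm p f < +oo)%E].

(* Bounded operators A : E -> L_p(mu); A x is a representative, so linearity
   is linearity almost everywhere. *)
Definition bounded_into_Lp (E : normedModType K) (p : \bar R)
    (A : E -> T -> K) : Prop :=
  [/\ forall x, in_Lp p (A x),
      forall (k : K) (x y : E),
        {ae mu, forall t, A (k *: x + y) t = k * A x t + A y t} &
      exists c : R, forall x, (Lp_norm p (A x) <= (c * rnorm x)%:E)%E].

Definition norm_into_Lp (E : normedModType K) (p : \bar R)
    (A : E -> T -> K) : R :=
  inf [set c : R | 0 <= c /\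
    forall x, (Lp_norm p (A x) <= (c * rnorm x)%:E)%E].

(* Bounded operators B : L_p(mu) -> E, as maps on representatives. The bound
   applied to a difference forces B f = B g whenever f = g almost everywhere;
   values of B outside L_p(mu) are irrelevant. *)
Definition bounded_from_Lp (E : normedModType K) (p : \bar R)
    (B : (T -> K) -> E) : Prop :=
  (forall (k : K) (f g : T -> K), in_Lp p f -> in_Lp p g ->
     B (fun t => k * f t + g t) = k *: B f + B g) /\
  (exists c : R, forall f, in_Lp p f ->
     ((rnorm (B f))%:E <= c%:E * Lp_norm p f)%E).

Definition norm_from_Lp (E : normedModType K) (p : \bar R)
    (B : (T -> K) -> E) : R :=
  inf [set c : R | 0 <= c /\
    forall f, in_Lp p f -> ((rnorm (B f))%:E <= c%:E * Lp_norm p f)%E].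

End Lp.

(** * p-integral operators *)

Section PIntegral.
Context (R : realType) (s : scalars).
Local Notation K := (scalar_field R s).
Context (p : \bar R) (X Y : normedModType K).

(* J_Y T = B i_p A with A : X -> L_oo(mu), B : L_p(mu) -> Y** and i_p the
   identity on representatives. For p < oo, mu is a probability measure; for
   p = oo it is an arbitrary measure: probability measures would not be enough
   there, e.g. J : c_0(I) -> l_oo(I) with I uncountable factors through
   l_oo(I), but not through L_oo of a probability measure. *)
Definition p_integral_factorization (T : X -> Y)
    d (S : measurableType d) (mu : {measure set S -> \bar R})
    (A : X -> S -> K) (B : (S -> K) -> dual (dual Y)) : Prop :=
  [/\ (p < +oo)%E -> mu [set: S] = 1%E,
      bounded_into_Lp mu +oo A,
      bounded_from_Lp mu p B &
      forall x, canonical_inclusion (T x) = B (A x)].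

Definition p_integral (T : X -> Y) : Prop :=
  exists d (S : measurableType d) (mu : {measure set S -> \bar R}) A B,
    p_integral_factorization T mu A B.

(* +oo when T is not p-integral *)
Definition p_integral_norm (T : X -> Y) : \bar R :=
  ereal_inf [set r : \bar R |
    exists d (S : measurableType d) (mu : {measure set S -> \bar R}) A B,
      p_integral_factorization T mu A B /\
      r = (norm_into_Lp mu +oo A * norm_from_Lp mu p B)%:E].

End PIntegral.

Arguments p_integral {R s} p {X Y} T.
Arguments p_integral_norm {R s} p {X Y} T.

(** * Nets and the local metric approximation property *)

Record directed (I : Type) (le : I -> I -> Prop) : Prop := {
  directed_inhabited : inhabited I;
  directed_refl : forall i, le i i;
  directed_trans : forall i j k, le i j -> le j k -> le i k;
  directed_ub : forall i j, exists k, le i k /\ le j k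
}.

(* the filter of tails of a net *)
Definition tails (I : Type) (le : I -> I -> Prop) : set_system I :=
  [set V | exists i, forall j, le i j -> V j].

Definition net_limsup (R : realType) (I : Type) (le : I -> I -> Prop)
    (u : I -> \bar R) : \bar R :=
  ereal_inf [set ereal_sup [set u j | j in [set j | le i j]] | i in [set: I]].

Definition finite_rank (K : numFieldType) (X Y : normedModType K) (T : X -> Y) :=
  exists n (y : 'I_n -> Y), forall x, exists c : 'I_n -> K,
    T x = \sum_(i < n) c i *: y i.

(* An operator ideal enters through its membership predicate A and its norm
   nA; "operator" means continuous linear map. *)
Definition local_MAP (R : realType) (s : scalars)
    (A : forall X Y : completeNormedModType (scalar_field R s),
      (X -> Y) -> Prop)
    (nA : forall X Y : completeNormedModType (scalar_field R s),
      (X -> Y) -> \bar R)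
    (X : completeNormedModType (scalar_field R s)) : Prop :=
  forall (Y : completeNormedModType (scalar_field R s)) (T : {linear X -> Y}),
    continuous T -> A X Y T ->
    exists (I : Type) (le : I -> I -> Prop) (T_ : I -> {linear X -> Y}),
      [/\ directed le,
          forall i, [/\ continuous (T_ i), finite_rank (T_ i) & A X Y (T_ i)],
          forall x, (fun i => T_ i x) @ tails le --> T x &
          (net_limsup le (fun i => nA X Y (T_ i)) <= nA X Y T)%E].

(* Main.v *)
From HB Require Import structures.
Require Import Defs.
From mathcomp Require Import all_boot all_order all_algebra.
From mathcomp Require Import complex.
From mathcomp Require Import all_classical all_reals all_analysis.
From mathcomp Require Import measurable_realfun ess_sup_inf.
From mathcomp Require Import lra.

(** Let [canonical_inclusion (T x) = B (A x)] with [A : X -> L_oo(mu)] and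
    [B : L_p(mu) -> Y**]. Given finitely many points [x k] of [X] and an error,
    the idea is to replace [mu] by a measure on a finite set.

    Cut the measure space into finitely many measurable cells on which the
    functions [A (x k)] are almost constant ([finite_oscillation]). On each cell
    of positive measure, replace evaluation by a functional [psi i] on [X] that
    lies in the essential range of [A x] on the cell for every [x]
    ([cell_functional]). It is obtained from the Hahn-Banach theorem applied to
    the essential supremum of the real part, which is sublinear; unlike an
    average over the cell, this works for the arbitrary measures that occur when
    [p] is infinite. The map [x |-> (psi i x)_i] goes to the bounded functions on
    the finite set of cells, its norm is at most that of [A], and followed by [B]
    it approximates [T] at the points [x k].

    The restriction of [B] to step functions still takes its values in the
    bidual of [Y]. Since it is defined on a finite-dimensional space, local
    reflexivity replaces it by an operator into [Y] with almost the same norm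
    and almost the same values where these already lie in [Y]
    ([lift_factor_step]). The form of local reflexivity used here
    ([local_reflexivity]) concerns finite systems of inequalities: if
    [\sum_i a j i *: u i] is within [r j] of [y j] for vectors [u i] of the
    bidual, then it is within any [rho j > r j] for suitable vectors of [Y]. It
    follows from Hahn-Banach separation in a finite power of [Y], and the norm
    of an operator on step functions is controlled by finitely many such
    inequalities, imposed on a finite net of the unit ball.

    Composing the two maps gives a finite rank operator with a factorization
    through the image of [mu] on the set of cells, of norm almost that of the
    given factorization ([finite_rank_approximation]). These operators, indexed
    by the finite sets of points and the errors, form the required net. *)

Set Implicit Arguments.
Unset Strict Implicit.
Unset Printing Implicit Defensive.

Import Order.TTheory GRing.Theory Num.Theory.
Import numFieldNormedType.Exports.

Local Open Scope classical_set_scope.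
Local Open Scope ring_scope.


(** * Real and complex scalars treated uniformly *)

Section ScalarLemmas.
Context (R : realType) (s : scalars).
Local Notation K := (scalar_field R s).
Local Notation "r %:S" := (scalar_of_real s r) (at level 2, format "r %:S").
Implicit Types (k l : K) (r : R).

(** Over the real scalars the imaginary unit is taken to be [0]: the
    decomposition of a scalar into real and imaginary parts, and the passage
    from real parts to functionals, then read the same over both fields. *)
Definition imag_unit : K :=
  match s return scalar_field R s with
  | RealScalars => 0
  | ComplexScalars => 'i%C
  end.

Lemma imag_unit_cases :
  imag_unit = 0 \/ imag_unit * imag_unit = -1.
Proof.
rewrite /imag_unit; case: s => /=; [by left|right].
by rewrite -expr2 sqr_i.
Qed.

Lemma scalar_of_real1 : 1%:S = 1 :> K.
Proof. by rewrite /scalar_of_real; case: s. Qed.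

Lemma scalar_of_realN r : (- r)%:S = - r%:S :> K.
Proof. by rewrite /scalar_of_real; case: s => //=; rewrite rmorphN. Qed.

Lemma scalar_of_realB r r' : (r - r')%:S = r%:S - r'%:S :> K.
Proof. by rewrite scalar_of_realD scalar_of_realN. Qed.

Lemma scalar_reD k l : scalar_re (k + l) = scalar_re k + scalar_re l.
Proof. by rewrite /scalar_re; case: s k l => //= k l; rewrite raddfD. Qed.

Lemma scalar_re0 : scalar_re (0 : K) = 0.
Proof. by rewrite -(scalar_of_real0 R s) scalar_of_realK. Qed.

Lemma scalar_reN k : scalar_re (- k) = - scalar_re k.
Proof. by apply/eqP; rewrite -addr_eq0 -scalar_reD addNr scalar_re0. Qed.

Lemma scalar_reB k l : scalar_re (k - l) = scalar_re k - scalar_re l.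
Proof. by rewrite scalar_reD scalar_reN. Qed.

Lemma scalar_imB k l : scalar_im (k - l) = scalar_im k - scalar_im l.
Proof.
rewrite /scalar_im; case: s k l => /= k l; first by rewrite subrr.
by rewrite raddfB.
Qed.

Lemma scalar_re_sum (I : finType) (F : I -> K) :
  scalar_re (\sum_i F i) = \sum_i scalar_re (F i).
Proof. exact: (big_morph _ scalar_reD scalar_re0). Qed.

Lemma scalar_reZ r k : scalar_re (r%:S * k) = r * scalar_re k.
Proof.
rewrite /scalar_re /scalar_of_real; case: s k => //= -[a b] /=.
by rewrite mul0r subr0.
Qed.

Lemma scalar_re_imag k : scalar_re (imag_unit * k) = - scalar_im k.
Proof.
rewrite /scalar_re /scalar_im /imag_unit; case: s k => /= [k|[a b] /=].
  by rewrite mul0r oppr0.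
by rewrite mul0r sub0r mul1r.
Qed.

Lemma scalar_im_of_real r : scalar_im (r%:S : K) = 0.
Proof. by rewrite /scalar_im /scalar_of_real; case: s. Qed.

Lemma scalar_decomp k : k = (scalar_re k)%:S + imag_unit * (scalar_im k)%:S.
Proof.
rewrite /scalar_re /scalar_im /imag_unit /scalar_of_real.
case: s k => /= [k|[a b] /=]; first by rewrite mul0r addr0.
exact: complexE.
Qed.

Lemma modulus_re_le k : `|scalar_re k| <= modulus k.
Proof.
rewrite -(ler_scalar_of_real s) modulusE.
rewrite /scalar_of_real /scalar_re; case: s k => //= -[a b].
have := normc_ge_Re (a +i* b)%C; by rewrite /= normc_def.
Qed.

Lemma re_le_modulus k : scalar_re k <= modulus k.
Proof. exact: le_trans (ler_norm _) (modulus_re_le k). Qed.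

Lemma modulus_of_real r : modulus (r%:S : K) = `|r|.
Proof.
rewrite /modulus /scalar_re /scalar_of_real; case: s => //=.
by rewrite expr0n addr0 sqrtr_sqr.
Qed.

Lemma modulus_imag_le1 : modulus imag_unit <= 1.
Proof.
rewrite /modulus /scalar_re /imag_unit; case: s => /=; first by rewrite normr0 ler01.
by rewrite expr0n add0r expr1n sqrtr1.
Qed.

Lemma modulus_im_le k : `|scalar_im k| <= modulus k.
Proof.
rewrite -normrN -scalar_re_imag (le_trans (modulus_re_le _))// modulusM.
by rewrite ler_piMl ?modulus_ge0// modulus_imag_le1.
Qed.

Lemma modulus_le_re_im k : modulus k <= `|scalar_re k| + `|scalar_im k|.
Proof.
rewrite {1}(scalar_decomp k) (le_trans (modulusD _ _))// lerD//.
  by rewrite modulus_of_real.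
by rewrite modulusM modulus_of_real ler_piMl// modulus_imag_le1.
Qed.

Lemma modulus_sum (I : finType) (F : I -> K) :
  modulus (\sum_i F i) <= \sum_i modulus (F i).
Proof.
elim/big_rec2 : _ => [|i x y _ xy]; first by rewrite modulus0.
by rewrite (le_trans (modulusD _ _))// lerD2l.
Qed.

(** The phase is only required to have modulus at most [1], so that the scalar
    [0] is no exception. *)
Lemma phase_exists k : exists u : K, modulus u <= 1 /\ u * k = (modulus k)%:S.
Proof.
have [->|k0] := eqVneq k 0.
  by exists 0; rewrite modulus0 ler01 mulr0 scalar_of_real0.
exists (`|k| / k); rewrite modulusE divfK//; split=> //.
rewrite -(ler_scalar_of_real s) modulusE normrM normfV normr_id divff ?normr_eq0//.
by rewrite scalar_of_real1.
Qed.

Lemma rnorm_sum (E : normedModType K) (I : finType) (F : I -> E) :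
  rnorm (\sum_i F i) <= \sum_i rnorm (F i).
Proof.
elim/big_rec2 : _ => [|i x y _ xy]; first by rewrite rnorm0.
by rewrite (le_trans (rnormD _ _))// lerD2l.
Qed.

End ScalarLemmas.

(** * The Hahn-Banach theorem for sublinear functionals *)

Section HahnBanach.
Context (R : realType) (s : scalars).
Local Notation K := (scalar_field R s).
Local Notation "r %:S" := (scalar_of_real s r) (at level 2, format "r %:S").
Context (E : lmodType K).
Implicit Types (Q q : E -> R) (x y z : E).

(** The inequality for nonnegative dilations suffices: applied to the inverse
    dilation it gives equality. *)
Definition sublinear Q : Prop :=
  (forall x y, Q (x + y) <= Q x + Q y) /\
  (forall c x, 0 <= c -> Q (c%:S *: x) <= c * Q x).

Definition real_linear (l : E -> R) : Prop :=
  (forall x y, l (x + y) = l x + l y) /\ (forall c x, l (c%:S *: x) = c * l x).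

Lemma sublinear0 Q : sublinear Q -> Q 0 = 0.
Proof.
move=> [Qadd Qhom]; apply/eqP; rewrite eq_le; apply/andP; split.
  by have := Qhom 0 0 (lexx _); rewrite scaler0 mul0r.
by have := Qadd 0 0; rewrite addr0; lra.
Qed.

Lemma sublinearZ Q c x : sublinear Q -> 0 <= c -> Q (c%:S *: x) = c * Q x.
Proof.
move=> sQ; rewrite le_eqVlt => /predU1P[<-|c0].
  by rewrite scalar_of_real0 scale0r mul0r sublinear0.
apply/eqP; rewrite eq_le sQ.2 ?(ltW c0)//= -ler_pdivlMl//.
have := sQ.2 c^-1 (c%:S *: x); rewrite invr_ge0 => /(_ (ltW c0)).
by rewrite scalerA -scalar_of_realM mulVf ?gt_eqF// scalar_of_real1 scale1r.
Qed.

Lemma sublinear_opp Q x : sublinear Q -> - Q (- x) <= Q x.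
Proof.
move=> sQ; have := sQ.1 x (- x); rewrite subrr (sublinear0 sQ); lra.
Qed.

Lemma le_mul_inf (A : set R) (a c : R) : A !=set0 -> 0 <= c ->
  (forall r, A r -> a <= c * r) -> a <= c * inf A.
Proof.
move=> [r0 Ar0]; rewrite le_eqVlt => /predU1P[<-|c0] aA.
  by have := aA _ Ar0; rewrite !mul0r.
rewrite -ler_pdivrMl//; apply: lb_le_inf; first by exists r0.
by move=> r Ar; rewrite ler_pdivrMl//; exact: aA.
Qed.

Lemma le_add_inf (A B : set R) (a : R) : A !=set0 -> B !=set0 ->
  (forall r r', A r -> B r' -> a <= r + r') -> a <= inf A + inf B.
Proof.
move=> A0 B0 aAB; rewrite -lerBlDr; apply: lb_le_inf => // r Ar.
rewrite lerBlDr addrC -lerBlDr; apply: lb_le_inf => // r' Br'.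
by rewrite lerBlDr addrC; exact: aAB.
Qed.

(** The infimum lies below [Q], is again sublinear, and is at most [- Q z] at
    [- z]. This serves twice: a minimal sublinear functional cannot be lowered
    in this way, hence is additive; and a linear form below the straightened
    functional takes the value [Q z] at [z]. *)
Definition straighten Q z x : R :=
  inf [set Q (x + r%:S *: z) - r * Q z | r in [set r : R | 0 <= r]].

Section Straighten.
Variables (Q : E -> R) (z : E).
Hypothesis sQ : sublinear Q.

Let straighten_ex x :
  [set Q (x + r%:S *: z) - r * Q z | r in [set r : R | 0 <= r]] !=set0.
Proof. by eexists; exists 0 => //=. Qed.

Lemma straighten_le x r : 0 <= r -> straighten Q z x <= Q (x + r%:S *: z) - r * Q z.
Proof.
move=> r0; apply: ge_inf; last by exists r.
exists (- Q (- x)) => _ [t /= t0 <-].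
have := sQ.1 (x + t%:S *: z) (- x).
by rewrite addrAC subrr add0r (sublinearZ _ sQ t0); lra.
Qed.

Lemma straighten_sublinear : sublinear (straighten Q z).
Proof.
split=> [x y|c x c0].
  apply: le_add_inf => // _ _ [r /= r0 <-] [t /= t0 <-].
  apply: (le_trans (straighten_le _ (addr_ge0 r0 t0))).
  rewrite scalar_of_realD scalerDl addrACA.
  by have := sQ.1 (x + r%:S *: z) (y + t%:S *: z); lra.
apply: le_mul_inf => // _ [r /= r0 <-].
apply: (le_trans (straighten_le _ (mulr_ge0 c0 r0))).
rewrite scalar_of_realM -scalerA -scalerDr.
by have := sQ.2 c (x + r%:S *: z) c0; lra.
Qed.

Lemma straighten_le_self x : straighten Q z x <= Q x.
Proof.
have := straighten_le x (lexx 0).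
by rewrite mul0r subr0 scalar_of_real0 scale0r addr0.
Qed.

End Straighten.

(** Zorn's lemma applies because the pointwise infimum of a chain of
    sublinear functionals is sublinear; it is finite as [q x] is at least
    [- Q (- x)] for every [q] below [Q]. *)
Lemma minimal_sublinear_exists Q : sublinear Q ->
  exists q, [/\ sublinear q, forall x, q x <= Q x &
    forall q', sublinear q' -> (forall x, q' x <= q x) -> q' = q].
Proof.
move=> sQ.
pose T := {q : E -> R | sublinear q /\ forall x, q x <= Q x}.
pose below (a b : T) : bool := `[< forall x, sval b x <= sval a x >].
(* maximal for this relation means minimal as a functional *)
have [|||A Atot|[q [sq qQ]] qmin] := @Zorn T below.
- by move=> t; apply/asboolP.
- move=> a b c /asboolP ab /asboolP bc; apply/asboolP => x.
  exact: le_trans (bc x) (ab x).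
- move=> [a pa] [b pb] /asboolP /= ab /asboolP /= ba; apply: eq_exist.
  by apply/funext => x; apply/eqP; rewrite eq_le ab ba.
- have [A0|/set0P[a0 Aa0]] := eqVneq A set0.
    (* the empty chain is bounded by [Q] itself *)
    by exists (exist _ Q (conj sQ (fun=> lexx _))) => a; rewrite A0.
  pose V x := [set sval a x | a in A].
  have V0 x : V x !=set0 by exists (sval a0 x), a0.
  have Vle x a : A a -> inf (V x) <= sval a x.
    move=> Aa; apply: ge_inf; last by exists a.
    exists (- Q (- x)) => _ [[b [sb bQ]] /= Ab <-].
    by rewrite (le_trans _ (sublinear_opp x sb))// lerN2.
  have sI : sublinear (fun x => inf (V x)) /\ forall x, inf (V x) <= Q x.
    split; last by move=> x; apply: le_trans (Vle x _ Aa0) _; exact: (proj2_sig a0).2.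
    split=> [x y|c x c0].
      apply: le_add_inf => // _ _ [a Aa <-] [b Ab <-].
      have [] := Atot _ _ Aa Ab => /asboolP ab.
        apply: (le_trans (Vle _ _ Ab)); have [[badd _] _] := proj2_sig b.
        by rewrite (le_trans (badd _ _))// lerD2r.
      apply: (le_trans (Vle _ _ Aa)); have [[aadd _] _] := proj2_sig a.
      by rewrite (le_trans (aadd _ _))// lerD2l.
    apply: le_mul_inf => // _ [a Aa <-]; apply: (le_trans (Vle _ _ Aa)).
    by have [[_ ahom] _] := proj2_sig a; exact: ahom.
  pose t : T := exist _ (fun x => inf (V x)) sI.
  by exists t => a Aa; apply/asboolP => x /=; exact: Vle.
- exists q; split=> // q' sq' q'q.
  have q'P : sublinear q' /\ forall x, q' x <= Q x.
    by split=> // x; exact: le_trans (q'q x) (qQ x).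
  pose t : T := exist _ q' q'P.
  by have /(congr1 sval) := qmin t (asboolT q'q).
Qed.

(** Minimal sublinear functionals are linear, and starting the search below
    the functional straightened at [z] makes the linear form attain [Q z]. *)
Lemma Hahn_Banach_sublinear Q z : sublinear Q ->
  exists l, [/\ real_linear l, forall x, l x <= Q x & l z = Q z].
Proof.
move=> sQ.
have [l [sl lQ lmin]] := minimal_sublinear_exists (straighten_sublinear z sQ).
have ladd x y : l (x + y) = l x + l y.
  apply/eqP; rewrite eq_le sl.1 /=.
  have /(congr1 (@^~ x)) := lmin _ (straighten_sublinear y sl) (straighten_le_self y sl).
  have := straighten_le y sl x ler01.
  by rewrite scalar_of_real1 scale1r mul1r => + e; rewrite e; lra.
have lN x : l (- x) = - l x.
  by have := ladd x (- x); rewrite subrr (sublinear0 sl); lra.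
have lhom c x : 0 <= c -> l (c%:S *: x) = c * l x.
  move=> c0; apply/eqP; rewrite eq_le sl.2//=.
  by have := sl.2 c (- x) c0; rewrite scalerN !lN; lra.
exists l; split.
- split=> // c x; have [/lhom//|c0] := leP 0 c.
  have := lhom (- c) x; rewrite scalar_of_realN scaleNr lN oppr_ge0 ltW// => /(_ isT).
  by lra.
- by move=> x; apply: le_trans (lQ x) _; exact: straighten_le_self.
- apply/eqP; rewrite eq_le; apply/andP; split.
    by apply: le_trans (lQ z) _; exact: straighten_le_self.
  have := straighten_le z sQ (- z) ler01; have := lQ (- z).
  rewrite scalar_of_real1 scale1r mul1r addNr (sublinear0 sQ) lN; lra.
Qed.

End HahnBanach.

(** * Functionals and their real parts *)

Section Duality.
Context (R : realType) (s : scalars).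
Local Notation K := (scalar_field R s).
Local Notation "r %:S" := (scalar_of_real s r) (at level 2, format "r %:S").
Context (E : normedModType K).
Implicit Types (f g : dual E) (x y : E) (k : K).

Lemma dualD f x y : f (x + y) = f x + f y.
Proof. by have := dual_linear f 1 x y; rewrite !scale1r. Qed.

Lemma dual0 f : f 0 = 0.
Proof. by apply: (addrI (f 0)); rewrite -dualD !addr0. Qed.

Lemma dualZ f k x : f (k *: x) = k * f x.
Proof. by have := dual_linear f k x 0; rewrite !addr0 dual0 addr0. Qed.

Lemma dualN f x : f (- x) = - f x.
Proof. by rewrite -scaleN1r dualZ mulN1r. Qed.

Lemma dual_sum f (I : finType) (F : I -> E) : f (\sum_i F i) = \sum_i f (F i).
Proof. by apply: (big_morph (f : E -> K)) => [x y|]; rewrite ?dualD ?dual0. Qed.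

Lemma dual_addE f g x : (f + g) x = f x + g x. Proof. by []. Qed.

Lemma dual_scaleE k f x : (k *: f) x = k * f x. Proof. by []. Qed.

Lemma dual_oppE f x : (- f) x = - f x. Proof. by []. Qed.

Lemma dual_sumE (I : finType) (F : I -> dual E) x :
  (\sum_i F i) x = \sum_i F i x.
Proof. by apply: (big_morph (fun f : dual E => f x : K)). Qed.

Lemma dual_eq f g : (forall x, f x = g x) -> f = g.
Proof. by move=> fg; apply/val_inj/funext. Qed.

Lemma dual_of_bounded_linear (f : E -> K^o) c :
  (forall k x y, f (k *: x + y) = k * f x + f y) -> 0 <= c ->
  (forall x, modulus (f x) <= c * rnorm x) -> f \in @functional R s E.
Proof.
move=> flin c0 fc; apply/functionalP.
have lf : linear f by exact: flin.
split=> //.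
pose F : {linear E -> K^o} := HB.pack f (GRing.isLinear.Build _ _ _ _ f lf).
apply: (@bounded_linear_continuous _ _ _ F); apply/linear_boundedP.
exists c%:S; split=> [|r cr x].
  by apply: ger0_real; rewrite -(scalar_of_real0 R s) ler_scalar_of_real.
rewrite (le_trans (y := c%:S * `|x|))//; last by rewrite ler_wpM2r// ltW.
by rewrite -modulusE -rnormE -scalar_of_realM ler_scalar_of_real.
Qed.

(** A bound on the real part of a functional bounds its modulus, since the
    phase of [f x] can be absorbed into [x]. *)
Lemma modulus_le_of_re f c : 0 <= c ->
  (forall x, scalar_re (f x) <= c * rnorm x) ->
  forall x, modulus (f x) <= c * rnorm x.
Proof.
move=> c0 fc x; have [u [u1 ufx]] := phase_exists (f x).
have := fc (u *: x); rewrite dualZ ufx scalar_of_realK => /le_trans; apply.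
by rewrite rnormZ ler_wpM2l// ler_piMl// rnorm_ge0.
Qed.

Lemma dual_eq0_of_re f : (forall x, scalar_re (f x) <= 0) -> f = 0.
Proof.
move=> f0; apply: dual_eq => x; apply: modulus_eq0; apply/eqP.
rewrite eq_le modulus_ge0 andbT -(mul0r (rnorm x)).
by apply: modulus_le_of_re => // y; rewrite mul0r.
Qed.

Lemma dual_norming f (eps : R) : 0 < eps ->
  exists x, rnorm x <= 1 /\ dual_rnorm f - eps <= scalar_re (f x).
Proof.
move=> eps0; apply: contrapT => /forallNP nx.
have {}nx x : rnorm x <= 1 -> scalar_re (f x) < dual_rnorm f - eps.
  by move=> x1; rewrite ltNge; apply/negP => fx; apply: (nx x).
have c0 : 0 < dual_rnorm f - eps.
  by have := nx 0; rewrite dual0 scalar_re0 rnorm0 => /(_ ler01).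
suff : dual_rnorm f <= dual_rnorm f - eps by lra.
apply: dual_rnorm_le; first exact: ltW.
apply: modulus_le_of_re; first exact: ltW.
move=> x; have [x0|x0] := eqVneq (rnorm x) 0.
  by rewrite (rnorm_eq0 x0) dual0 scalar_re0 rnorm0 mulr0.
have xgt0 : 0 < rnorm x by rewrite lt_def x0 rnorm_ge0.
rewrite -ler_pdivrMr// mulrC -scalar_reZ -dualZ; apply: ltW; apply: nx.
by rewrite rnormZ modulus_of_real ger0_norm ?invr_ge0 ?rnorm_ge0// mulVf.
Qed.

(** The imaginary part of a functional is determined by its real part, so
    every bounded real-linear form is the real part of a functional. *)
Lemma dual_of_real_linear (l : E -> R) c : real_linear l -> 0 <= c ->
  (forall x, l x <= c * rnorm x) ->
  exists f : dual E, forall x, scalar_re (f x) = l x.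
Proof.
move=> [ladd lhom] c0 lc.
pose i := imag_unit R s.
pose f x : K^o := (l x)%:S - i * (l (i *: x))%:S.
have fadd x y : f (x + y) = f x + f y.
  by rewrite /f scalerDr !ladd !scalar_of_realD mulrDr opprD addrACA.
have fhom r x : f (r%:S *: x) = r%:S * f x.
  have -> : f (r%:S *: x) = (r * l x)%:S - i * (r * l (i *: x))%:S.
    have ir : i *: (r%:S *: x) = r%:S *: (i *: x) by rewrite !scalerA mulrC.
    by rewrite /f ir !lhom.
  by rewrite !scalar_of_realM mulrBr mulrCA.
have fimag x : f (i *: x) = i * f x.
  have l0 : l 0 = 0 by have := lhom 0 0; rewrite scaler0 mul0r.
  have lN y : l (- y) = - l y.
    by have := lhom (-1) y; rewrite scalar_of_realN scalar_of_real1 scaleN1r mulN1r.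
  rewrite /f /i; have [->|ii] := imag_unit_cases R s.
    by rewrite !scale0r !mul0r subr0 l0 scalar_of_real0.
  by rewrite scalerA ii scaleN1r lN scalar_of_realN mulrN opprK mulrBr mulrA ii
    mulN1r opprK addrC.
have flin k x y : f (k *: x + y) = k * f x + f y.
  by rewrite fadd {1}(scalar_decomp k) scalerDl fadd -scalerA fimag !fhom
    mulrA -mulrDl -scalar_decomp.
have fre x : scalar_re (f x) = l x.
  rewrite /f scalar_reB scalar_of_realK scalar_re_imag.
  suff -> : scalar_im (l (i *: x))%:S = 0 by rewrite oppr0 subr0.
  by rewrite scalar_im_of_real.
have fmod x : modulus (f x) <= c * rnorm x.
  have [u [u1 ufx]] := phase_exists (f x).
  have f0 : f 0 = 0 by apply: (addrI (f 0)); rewrite -fadd !addr0.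
  have := flin u x 0; rewrite !addr0 f0 addr0 ufx => /(congr1 scalar_re).
  rewrite fre scalar_of_realK => <-; apply: le_trans (lc _) _.
  by rewrite rnormZ ler_wpM2l// ler_piMl// rnorm_ge0.
by exists (Dual (dual_of_bounded_linear flin c0 fmod)).
Qed.

End Duality.

(** * Local reflexivity for finite systems of inequalities *)

Section LocalReflexivity.
Context (R : realType) (s : scalars).
Local Notation K := (scalar_field R s).
Local Notation "r %:S" := (scalar_of_real s r) (at level 2, format "r %:S").
Context (Y : normedModType K) (I J : finType).
Variables (a : J -> I -> K) (rho : J -> R).
Hypothesis rho_gt0 : forall j, 0 < rho j.
Implicit Types (w : {ffun J -> Y}) (v : I -> Y).

(** The infimum of these values is the distance from [w] to the range of the
    matrix [a], for the weighted maximum of [rnorm (w j) / rho j]. *)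
Definition gauge_values w : set R :=
  [set c | 0 <= c /\
     exists v, forall j, rnorm (w j + \sum_i a j i *: v i) <= c * rho j].

Definition range_gauge w : R := inf (gauge_values w).

Lemma gauge_values_nonempty w : gauge_values w !=set0.
Proof.
exists (\sum_j rnorm (w j) / rho j); split.
  by apply: sumr_ge0 => j _; rewrite divr_ge0 ?rnorm_ge0// ltW.
exists (fun=> 0) => j; rewrite big1 ?addr0; last by move=> i _; rewrite scaler0.
rewrite -ler_pdivrMr// (bigD1 j)//= lerDl sumr_ge0// => k _.
by rewrite divr_ge0 ?rnorm_ge0// ltW.
Qed.

Lemma range_gauge_le w c v : 0 <= c ->
  (forall j, rnorm (w j + \sum_i a j i *: v i) <= c * rho j) ->
  range_gauge w <= c.
Proof. by move=> c0 wc; apply: ge_inf; [exists 0 => ? []|split=> //; exists v]. Qed.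

Lemma range_gauge_sublinear : sublinear range_gauge.
Proof.
split=> [w w'|c w c0].
  apply: le_add_inf; [exact: gauge_values_nonempty..|].
  move=> r r' [r0 [v vr]] [r'0 [v' vr']].
  apply: (@range_gauge_le _ _ (fun i => v i + v' i)); first exact: addr_ge0.
  move=> j; rewrite mulrDl (le_trans _ (lerD (vr j) (vr' j)))//.
  rewrite (le_trans _ (rnormD _ _))// ffunE addrACA -big_split/=.
  by under eq_bigr do rewrite scalerDr.
apply: le_mul_inf; [exact: gauge_values_nonempty|exact: c0|].
move=> r [r0 [v vr]].
apply: (@range_gauge_le _ _ (fun i => c%:S *: v i)); first exact: mulr_ge0.
move=> j; under eq_bigr do rewrite scalerA mulrC -scalerA.
rewrite ffunE -scaler_sumr -scalerDr rnormZ modulus_of_real ger0_norm//.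
by rewrite -mulrA ler_wpM2l.
Qed.

Definition ffun_single (j : J) (y : Y) : {ffun J -> Y} :=
  [ffun k => if k == j then y else 0].

Lemma ffun_single_sum (w : {ffun J -> Y}) : w = \sum_j ffun_single j (w j).
Proof.
apply/ffunP => k; rewrite sum_ffunE (bigD1 k)//= ffunE eqxx big1 ?addr0//.
by move=> j jk; rewrite ffunE eq_sym (negbTE jk).
Qed.

Lemma ffun_singleD j x y : ffun_single j (x + y) = ffun_single j x + ffun_single j y.
Proof. by apply/ffunP => k; rewrite !ffunE; case: ifP; rewrite ?addr0. Qed.

Lemma ffun_singleZ j k x : ffun_single j (k *: x) = k *: ffun_single j x.
Proof. by apply/ffunP => k'; rewrite !ffunE; case: ifP; rewrite ?scaler0. Qed.

(** If no [v] satisfies the inequalities, then [- y] is at distance at least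
    [1] from the range of [a], and Hahn-Banach gives functionals [phi j] on [Y]
    that annihilate the range, satisfy [\sum_j rho j * dual_rnorm (phi j) <= 1]
    and take a value at least [1] on [- y]. Since the [phi j] annihilate the
    range of [a], the [u i] contribute nothing when the inequalities in the
    bidual are tested on the [phi j], and those give the upper bound
    [\sum_j r j * dual_rnorm (phi j)]. As [r j < rho j], this is a
    contradiction. *)
Lemma local_reflexivity (u : I -> dual (dual Y)) (y : J -> Y) (r : J -> R) :
  (forall j, 0 <= r j < rho j) ->
  (forall j, rnorm (\sum_i a j i *: u i - canonical_inclusion (y j)) <= r j) ->
  exists v, forall j, rnorm (\sum_i a j i *: v i - y j) < rho j.
Proof.
move=> r_rho uyr; apply: contrapT => /forallNP nv.
pose z : {ffun J -> Y} := [ffun j => - y j].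
have z_ge1 : 1 <= range_gauge z.
  apply: lb_le_inf; first exact: gauge_values_nonempty.
  move=> c [c0 [v vc]]; rewrite leNgt; apply/negP => c1; apply: (nv v) => j.
  have := vc j; rewrite ffunE addrC => /le_lt_trans; apply.
  by rewrite gtr_pMl.
have [l [[ladd lhom] lle lz]] := Hahn_Banach_sublinear z range_gauge_sublinear.
have l_sum (P : finType) (F : P -> {ffun J -> Y}) : l (\sum_i F i) = \sum_i l (F i).
  apply: (big_morph l ladd); by have := lhom 0 0; rewrite scaler0 mul0r.
have l_gauge w c : 0 <= c -> (forall j, rnorm (w j) <= c * rho j) -> l w <= c.
  move=> c0 wc; apply: le_trans (lle w) _.
  apply: (@range_gauge_le _ _ (fun=> 0)) => // j.
  by rewrite big1 ?addr0// => i _; rewrite scaler0.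
have l_range v : l [ffun j => \sum_i a j i *: v i] <= 0.
  apply: le_trans (lle _) _; apply: (@range_gauge_le _ _ (fun i => - v i)) => // j.
  rewrite ffunE -big_split/= big1 ?rnorm0 ?mul0r// => i _.
  by rewrite scalerN subrr.
have phiP j : exists phi : dual Y, forall x, scalar_re (phi x) = l (ffun_single j x).
  apply: (@dual_of_real_linear _ _ _ _ (rho j)^-1).
  - split=> [x x'|c x]; first by rewrite ffun_singleD ladd.
    by rewrite ffun_singleZ lhom.
  - by rewrite invr_ge0 ltW.
  - move=> x; apply: l_gauge => [|k]; first by rewrite mulr_ge0 ?rnorm_ge0// invr_ge0 ltW.
    rewrite ffunE; case: eqP => [->|_]; last first.
      by rewrite rnorm0 !mulr_ge0 ?rnorm_ge0// ?invr_ge0 ltW.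
    by rewrite mulrAC mulVf ?mul1r// gt_eqF.
have {phiP}[phi phiE] := choice phiP.
have lE w : l w = scalar_re (\sum_j phi j (w j)).
  rewrite {1}(ffun_single_sum w) l_sum scalar_re_sum.
  by apply: eq_bigr => j _; rewrite phiE.
have phi_range i : \sum_j a j i *: phi j = 0.
  apply: dual_eq0_of_re => x; rewrite dual_sumE.
  have := l_range (fun k => if k == i then x else 0); rewrite lE; apply: le_trans.
  rewrite le_eqVlt; apply/orP; left; apply/eqP; congr scalar_re.
  apply: eq_bigr => j _; rewrite ffunE dual_scaleE (bigD1 i)//= eqxx.
  rewrite big1 ?addr0 ?dualZ// => k /negbTE->; exact: scaler0.
(* approximately norming vectors [x j], scaled by [rho j], lie in the unit
   ball of the gauge *)
have norms_le1 : \sum_j rho j * dual_rnorm (phi j) <= 1.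
  apply/ler_addgt0Pr => e e0.
  pose e' : R := e / (1 + \sum_j rho j).
  have rho_ge0 : 0 <= \sum_j rho j by apply: sumr_ge0 => j _; exact: ltW.
  have e'0 : 0 < e' by rewrite divr_gt0// ltr_wpDr.
  have [x xP] := choice (fun j => dual_norming (phi j) e'0).
  have : l [ffun j => (rho j)%:S *: x j] <= 1.
    apply: l_gauge => // j; rewrite ffunE rnormZ modulus_of_real gtr0_norm//.
    by rewrite mul1r ler_piMr ?(xP j).1// ltW.
  rewrite lE scalar_re_sum => lx1.
  have : \sum_j rho j * dual_rnorm (phi j) <=
      \sum_j (scalar_re (phi j ([ffun j => (rho j)%:S *: x j] j)) + e' * rho j).
    apply: ler_sum => j _; rewrite ffunE dualZ scalar_reZ.
    rewrite (mulrC e') -mulrDr ler_wpM2l ?(ltW (rho_gt0 j))//.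
    by rewrite -lerBlDr (xP j).2.
  rewrite big_split/= -mulr_sumr => /le_trans; apply; apply: lerD => //.
  by rewrite /e' mulrAC ler_pdivrMr ?ltr_wpDr// ler_pM2l// lerDr.
have : 1 <= \sum_j r j * dual_rnorm (phi j).
  apply: le_trans z_ge1 _; rewrite -lz lE.
  have -> : \sum_j phi j (z j) =
      \sum_j (\sum_i a j i *: u i - canonical_inclusion (y j)) (phi j).
    under [RHS]eq_bigr do rewrite dual_addE dual_oppE dual_sumE.
    rewrite big_split/= exchange_big/= [X in _ = X + _]big1; last first.
      move=> i _; rewrite -[RHS](dual0 (u i)) -(phi_range i) dual_sum.
      by apply: eq_bigr => j _; rewrite dualZ.
    by rewrite add0r; apply: eq_bigr => j _; rewrite ffunE dualN.
  apply: le_trans (re_le_modulus _) _; apply: le_trans (modulus_sum _) _.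
  apply: ler_sum => j _; apply: le_trans (dual_rnorm_bound _ _) _.
  by rewrite rnorm_dual ler_wpM2r ?dual_rnorm_ge0// -rnorm_dual.
rewrite leNgt => /negP; apply.
have diff_ge0 j : 0 <= (rho j - r j) * dual_rnorm (phi j).
  by rewrite mulr_ge0 ?dual_rnorm_ge0// subr_ge0; have /andP[_ /ltW] := r_rho j.
(* strictness fails only if every [phi j] is zero, where the sum is [0] *)
have rE : \sum_j r j * dual_rnorm (phi j) =
    \sum_j rho j * dual_rnorm (phi j) - \sum_j (rho j - r j) * dual_rnorm (phi j).
  by rewrite -sumrB; apply: eq_bigr => j _; rewrite -mulrBl opprB addrC subrK.
have [/eqP|nz] := eqVneq (\sum_j (rho j - r j) * dual_rnorm (phi j)) 0.
  rewrite psumr_eq0// => /allP z0; rewrite big1 ?ltr01// => j _.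
  have := z0 j; rewrite mem_index_enum => /(_ isT) /=; rewrite mulf_eq0.
  have /andP[_ rj] := r_rho j; rewrite subr_eq0 (gt_eqF rj) /= => /eqP->.
  exact: mulr0.
have : 0 < \sum_j (rho j - r j) * dual_rnorm (phi j).
  by rewrite lt_def nz sumr_ge0.
by rewrite rE; lra.
Qed.

End LocalReflexivity.

(** * Norms of scalar functions in Lebesgue spaces *)

Section LpNorm.
Context (R : realType) (s : scalars).
Local Notation K := (scalar_field R s).
Local Notation "r %:S" := (scalar_of_real s r) (at level 2, format "r %:S").
Context d (T : measurableType d) (mu : {measure set T -> \bar R}).
Implicit Types (f g : T -> K) (p : \bar R).

Definition scalar_measurable f : Prop :=
  measurable_fun setT (fun t => scalar_re (f t)) /\
  measurable_fun setT (fun t => scalar_im (f t)).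

Lemma scalar_measurableB f g : scalar_measurable f -> scalar_measurable g ->
  scalar_measurable (fun t => f t - g t).
Proof.
move=> [fr fi] [gr gi]; split.
  by under eq_fun do rewrite scalar_reB; exact: measurable_funB.
by under eq_fun do rewrite scalar_imB; exact: measurable_funB.
Qed.

Lemma modulusE_sqrt (k : K) :
  modulus k = Num.sqrt (scalar_re k ^+ 2 + scalar_im k ^+ 2).
Proof.
rewrite /modulus /scalar_re /scalar_im; case: s k => //= [k|[a b]//].
by rewrite expr0n addr0 sqrtr_sqr.
Qed.

Lemma measurable_modulus f : scalar_measurable f ->
  measurable_fun setT (fun t => modulus (f t)).
Proof.
move=> [fr fi]; under eq_fun do rewrite modulusE_sqrt.
under eq_fun do rewrite -powR12_sqrt ?addr_ge0 ?sqr_ge0//.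
apply: (@measurableT_comp _ _ _ _ _ _ (@powR R ^~ 2^-1)) => //.
by apply: measurable_funD; apply: measurable_funX.
Qed.

Lemma le_Lp_norm p f g : (1%:E <= p)%E ->
  scalar_measurable f -> scalar_measurable g ->
  {ae mu, forall t, modulus (f t) <= modulus (g t)} ->
  (Lp_norm mu p f <= Lp_norm mu p g)%E.
Proof.
move=> p1 mf mg fg; rewrite /Lp_norm unlock; case: p p1 => [r|_|//].
- rewrite lee_fin => r1; have r0 : 0 < r by rewrite (lt_le_trans ltr01).
  apply: gt0_ler_poweR; rewrite ?invr_ge0 ?(ltW r0)//.
  + by rewrite in_itv/= leey andbT integral_ge0// => t _; exact: poweR_ge0.
  + by rewrite in_itv/= leey andbT integral_ge0// => t _; exact: poweR_ge0.
  have meas h : scalar_measurable h ->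
      measurable_fun setT (fun t => (`|(modulus (h t) : R)%:E| `^ r)%E : \bar R).
    move=> mh; apply: (measurableT_comp (measurable_poweR r)).
    by apply: measurableT_comp => //; apply/measurable_EFinP/measurable_modulus.
  apply: ae_ge0_le_integral => //; first by move=> t _; exact: poweR_ge0.
  + exact: meas.
  + by move=> t _; exact: poweR_ge0.
  + exact: meas.
  apply: filterS fg => t fgt _.
  apply: gt0_ler_poweR; rewrite ?(ltW r0)// ?in_itv/= ?leey ?andbT//.
  by rewrite lee_fin !ger0_norm ?modulus_ge0.
- case: ifPn => // mu0; apply: le_ess_sup; apply: filterS fg => t fgt /=.
  by rewrite lee_fin !ger0_norm ?modulus_ge0.
Qed.

Lemma Lp_normZ p (k : K) f : (1%:E <= p)%E -> scalar_measurable f ->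
  Lp_norm mu p (fun t => k * f t) = ((modulus k)%:E * Lp_norm mu p f)%E.
Proof.
move=> p1 mf; rewrite /Lp_norm unlock; case: p p1 => [r|_|//].
- rewrite lee_fin => r1; have r0 : 0 < r by rewrite (lt_le_trans ltr01).
  have meas : measurable_fun setT (fun t => (`|(modulus (f t) : R)%:E| `^ r)%E : \bar R).
    apply: (measurableT_comp (measurable_poweR r)).
    by apply: measurableT_comp => //; apply/measurable_EFinP/measurable_modulus.
  under eq_integral => t _ do rewrite modulusM EFinM abseM poweRM//.
  rewrite ge0_integralZl//; last 2 first.
    by move=> t _; exact: poweR_ge0.
    exact: poweR_ge0.
  rewrite poweRM ?poweR_ge0//; last first.
    by apply: integral_ge0 => t _; exact: poweR_ge0.
  rewrite -poweRrM mulfV ?gt_eqF// poweRe1// gee0_abs// lee_fin.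
  exact: modulus_ge0.
- case: ifPn => mu0; last by rewrite mule0.
  rewrite -ess_supZl ?modulus_ge0//; congr ess_sup; apply/funext => t /=.
  by rewrite modulusM normrM EFinM (ger0_norm (modulus_ge0 k)).
Qed.

(** Only an inequality for [p] infinite, since the norm vanishes when the
    measure is zero. *)
Lemma Lp_norm_cst_le p (k : K) : (1%:E <= p)%E ->
  ((p < +oo)%E -> mu [set: T] = 1%E) ->
  (Lp_norm mu p (fun=> k) <= (modulus k)%:E)%E.
Proof.
move=> p1 mu1; rewrite /Lp_norm unlock; case: p p1 mu1 => [r|_|//].
- rewrite lee_fin => r1 /(_ (ltry _)) mu1.
  have r0 : 0 < r by rewrite (lt_le_trans ltr01).
  rewrite integral_cst// mu1 mule1 poweR_EFin -powRrM mulfV ?gt_eqF//.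
  by rewrite powRr1// ger0_norm ?modulus_ge0.
- move=> _; case: ifPn => mu0; last by rewrite lee_fin modulus_ge0.
  apply/ess_supP; apply: nearW => t /=.
  by rewrite lee_fin ger0_norm ?modulus_ge0.
Qed.

Lemma Lp_norm_pinfty_ae f c : (Lp_norm mu +oo f <= c%:E)%E ->
  {ae mu, forall t, modulus (f t) <= c}.
Proof.
rewrite /Lp_norm unlock; case: ifPn => mu0.
  move/ess_supP; apply: filterS => t /=.
  by rewrite lee_fin ger0_norm ?modulus_ge0.
(* for the zero measure the norm carries no information, but every property
   holds almost everywhere *)
move=> _; exists setT; split=> //.
by apply/eqP; rewrite eq_le measure_ge0 andbT leNgt.
Qed.

Lemma Lp_norm_eq0_ae p f : (1%:E <= p)%E -> scalar_measurable f ->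
  Lp_norm mu p f = 0%E -> {ae mu, forall t, f t = 0}.
Proof.
move=> p1 mf f0; have : (fun t => (modulus (f t))%:E) = \0 %[ae mu].
  apply: Lnorm_eq0_eq0 f0; last by rewrite (lt_le_trans _ p1)// lte_fin ltr01.
  exact/measurable_EFinP/measurable_modulus.
by apply: filterS => t /(_ I) [] /modulus_eq0.
Qed.

End LpNorm.

Section Pushforward.
Context (R : realType) (s : scalars).
Local Notation K := (scalar_field R s).
Context d (T : measurableType d) d' (I : measurableType d')
  (mu : {measure set T -> \bar R}) (q : {mfun T >-> I}).

(** The pushforward by a bundled measurable function, so that its measure
    structure can be inferred. *)
Definition image_measure : set I -> \bar R := pushforward mu q.

Let image_measure0 : image_measure set0 = 0%E.
Proof. exact: measure0. Qed.

Let image_measure_ge0 A : (0 <= image_measure A)%E.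
Proof. exact: measure_ge0. Qed.

Let image_measure_sigma_additive : semi_sigma_additive image_measure.
Proof. exact: measure_semi_sigma_additive. Qed.

HB.instance Definition _ := isMeasure.Build _ _ _ image_measure
  image_measure0 image_measure_ge0 image_measure_sigma_additive.

Lemma image_measureT : image_measure setT = mu setT.
Proof. by rewrite /image_measure /pushforward preimage_setT. Qed.

Lemma Lp_norm_image_measure p (f : I -> K) : (1%:E <= p)%E ->
  scalar_measurable f -> Lp_norm image_measure p f = Lp_norm mu p (f \o q).
Proof.
move=> p1 mf; rewrite /Lp_norm unlock.
case: p p1 => [r|_|//].
- rewrite lee_fin => r1; have r0 : 0 < r by rewrite (lt_le_trans ltr01).
  have meas : measurable_fun setT (fun t => (`|(modulus (f t) : R)%:E| `^ r)%E : \bar R).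
    apply: (measurableT_comp (measurable_poweR r)).
    by apply: measurableT_comp => //; apply/measurable_EFinP/measurable_modulus.
  by rewrite /image_measure ge0_integral_pushforward// => t _; exact: poweR_ge0.
- have -> : (image_measure : {measure set I -> \bar R}) setT = mu setT := image_measureT.
  case: ifPn => // mu0.
  have mf' : measurable_fun setT (abse \o (fun i => (modulus (f i) : R)%:E)).
    by apply: measurableT_comp => //; apply/measurable_EFinP/measurable_modulus.
  by rewrite !ess_supEmu0//; apply: (measurableT_comp mf').
Qed.

End Pushforward.

(** * Finite nets of scalars and finite partitions *)

Section Grid.
Context (R : realType) (s : scalars).
Local Notation K := (scalar_field R s).
Local Notation "r %:S" := (scalar_of_real s r) (at level 2, format "r %:S").

Lemma real_grid (eta : R) : 0 < eta -> exists D : seq R, forall r, `|r| <= 1 ->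
  exists2 d, d \in D & `|d| <= `|r| /\ `|r - d| <= eta.
Proof.
move=> eta0; pose L := Num.truncn eta^-1.
exists [seq (-1) ^+ (b : bool) * (m%:R * eta) | b <- [:: true; false], m <- iota 0 L.+1].
move=> r r1; pose m := Num.truncn (`|r| / eta).
have /Num.Theory.truncn_itv /andP[m1 m2] : 0 <= `|r| / eta by rewrite divr_ge0// ltW.
move: m1 m2; rewrite -/m ler_pdivlMr// ltr_pdivrMr// => m1 m2.
have m0 : 0 <= m%:R * eta by rewrite mulr_ge0// ltW.
exists ((-1) ^+ (r < 0)%R * (m%:R * eta)).
  apply/allpairsP; exists (r < 0, m); split; [by rewrite !inE /=; case: (r < 0)| |by []].
  rewrite mem_iota/= add0n ltnS; apply: le_truncn.
  by rewrite -[leRHS]mul1r ler_wpM2r// invr_ge0 ltW.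
rewrite normrM normr_sign mul1r ger0_norm//; split=> //.
rewrite {1}(numEsign r) -mulrBr normrM normr_sign mul1r ger0_norm ?subr_ge0//.
by move: m2; rewrite -addn1 natrD mulrDl mul1r; lra.
Qed.

Lemma scalar_re_pair (a b : R) : scalar_re (a%:S + imag_unit R s * b%:S) = a.
Proof.
by rewrite scalar_reD scalar_of_realK scalar_re_imag scalar_im_of_real oppr0 addr0.
Qed.

Lemma scalar_im_pair_le (a b : R) : `|scalar_im (a%:S + imag_unit R s * b%:S)| <= `|b|.
Proof.
rewrite /scalar_im /scalar_of_real /imag_unit; case: s => /=; first by rewrite normr0.
by rewrite mul0r mul1r !add0r.
Qed.

(** Rounding real and imaginary parts towards zero keeps the approximants
    from exceeding the approximated scalar in modulus; monotonicity of a norm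
    then suffices to keep approximants of a vector in the unit ball. *)
Lemma scalar_grid (eta : R) : 0 < eta -> exists D : seq K,
  [/\ 0 \in D, 1 \in D & forall k : K, modulus k <= 1 ->
    exists2 d, d \in D & modulus d <= modulus k /\ modulus (k - d) <= eta].
Proof.
move=> eta0; have [D DP] := @real_grid (eta / 2) (divr_gt0 eta0 (ltr0n _ 2)).
exists (0 :: 1 :: [seq a%:S + imag_unit R s * b%:S | a <- D, b <- D]).
split; rewrite ?inE ?eqxx ?orbT// => k k1.
have im1 : `|scalar_im k| <= 1 by exact: le_trans (modulus_im_le k) k1.
have [a aD [a1 a2]] := DP _ (le_trans (modulus_re_le k) k1).
have [b bD [b1 b2]] := DP _ im1.
exists (a%:S + imag_unit R s * b%:S).
  by rewrite !inE; apply/orP; right; apply/orP; right; exact: allpairs_f.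
split.
  rewrite !modulusE_sqrt ler_sqrt ?addr_ge0 ?sqr_ge0// scalar_re_pair.
  rewrite -[leLHS](congr2 +%R (real_normK _) (real_normK _)) ?num_real//.
  rewrite -[leRHS](congr2 +%R (real_normK _) (real_normK _)) ?num_real//.
  rewrite lerD// lerXn2r ?nnegrE//.
  exact: le_trans (scalar_im_pair_le _ _) b1.
rewrite {1}(scalar_decomp k) opprD addrACA -mulrBr -!scalar_of_realB.
rewrite (le_trans (modulusD _ _))// modulusM !modulus_of_real.
by rewrite (splitr eta) lerD// (le_trans _ b2)// ler_piMl// modulus_imag_le1.
Qed.

End Grid.

(** An atom of a finite family of sets is encoded as the pattern of
    memberships shared by its points, which makes the type finite. *)
Definition atoms (B : finType) : Type := {ffun B -> bool}.
HB.instance Definition _ (B : finType) := Finite.on (atoms B).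
HB.instance Definition _ (B : finType) := isPointed.Build (atoms B) [ffun=> false].
HB.instance Definition _ (B : finType) := @isMeasurable.Build default_measure_display
  (atoms B) discrete_measurable discrete_measurable0
  discrete_measurableC discrete_measurableU.

Section Atoms.
Context d (T : measurableType d) (B : finType) (C : B -> set T).
Hypothesis mC : forall b, measurable (C b).

Definition atom_of (t : T) : atoms B := [ffun b => `[< C b t >]].

Lemma measurable_atom_of : measurable_fun setT atom_of.
Proof.
move=> _ Y _; rewrite setTI.
have -> : atom_of @^-1` Y = \bigcup_(i in Y) \bigcap_(b in [set: B])
    (if i b then C b else ~` C b).
  apply/seteqP; split => t /=.
    move=> Yt; exists (atom_of t) => // b _; rewrite ffunE.
    by case: ifPn => /asboolP.
  move=> [i Yi it]; suff -> : atom_of t = i by [].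
  apply/ffunP => b; rewrite ffunE; have := it b I.
  by case: (i b) => ?; apply/asboolP.
apply: fin_bigcup_measurable; first exact: finite_finset.
move=> i _; apply: fin_bigcap_measurable => // b _.
by case: (i b) => //; exact: measurableC.
Qed.

End Atoms.

(** The level sets at the multiples of [eps] in [-M, M] separate any two
    points of this range that are more than [eps] apart. *)
Lemma finite_oscillation (R : realType) d (T : measurableType d) (G : finType)
    (g : G -> T -> R) (M eps : R) :
  (forall j, measurable_fun setT (g j)) -> 0 < eps ->
  exists (B : finType) (q : {mfun T >-> atoms B}), forall j t t', q t = q t' ->
    `|g j t| <= M -> `|g j t'| <= M -> `|g j t - g j t'| <= eps.
Proof.
move=> mg eps0; pose L := (Num.truncn ((M + M) / eps)).+1.
pose C (b : G * 'I_L) := [set t | b.2%:R * eps - M <= g b.1 t].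
have mC b : measurable (C b).
  rewrite /C -[X in measurable X]setTI.
  by apply: measurable_fun_le.
pose q : {mfun T >-> atoms (G * 'I_L)%type} :=
  HB.pack (atom_of C) (isMeasurableFun.Build _ _ _ _ _ (measurable_atom_of mC)).
exists (G * 'I_L)%type, q.
have half j t t' : q t = q t' -> `|g j t| <= M -> `|g j t'| <= M ->
    g j t' <= g j t + eps.
  move=> qtt'; rewrite !ler_norml => /andP[t1 t2] /andP[t'1 t'2].
  rewrite leNgt; apply/negP => gap.
  pose k := (Num.truncn ((g j t + M) / eps)).+1.
  have tM0 : 0 <= (g j t + M) / eps by rewrite divr_ge0 ?(ltW eps0)//; lra.
  have /andP[k1 k2] := Num.Theory.truncn_itv tM0.
  rewrite ler_pdivlMr// in k1; rewrite ltr_pdivrMr// in k2.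
  rewrite -/k in k2.
  have keps : k%:R * eps <= g j t' + M.
    by rewrite /k -natr1 (mulrDl _ 1) mul1r; lra.
  have kL : (k < L)%N.
    rewrite ltnS truncn_ge_nat; last by rewrite divr_ge0 ?(ltW eps0)//; lra.
    by rewrite ler_pdivlMr//; lra.
  have := congr1 (fun f : atoms _ => f (j, Ordinal kL)) qtt'.
  rewrite /= !ffunE => ett'.
  have : C (j, Ordinal kL) t.
    by apply/asboolP; rewrite ett'; apply/asboolP; rewrite /C /=; lra.
  by rewrite /C /=; lra.
move=> j t t' qtt' tM t'M; rewrite ler_norml; apply/andP; split.
  by have := half j t t' qtt' tM t'M; lra.
by have := half j t' t (esym qtt') t'M tM; lra.
Qed.

(** * Functionals attached to a cell of positive measure *)

Section CellFunctional.
Context (R : realType) (s : scalars).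
Local Notation K := (scalar_field R s).
Local Notation "r %:S" := (scalar_of_real s r) (at level 2, format "r %:S").
Context d (T : measurableType d) (mu : {measure set T -> \bar R}).
Context (X : normedModType K) (A : X -> T -> K) (a : R).
Hypothesis A_linear : forall (k : K) x y,
  {ae mu, forall t, A (k *: x + y) t = k * A x t + A y t}.
Hypothesis a_ge0 : 0 <= a.
Hypothesis A_bounded : forall x, {ae mu, forall t, modulus (A x t) <= a * rnorm x}.

Lemma ae_linear0 : {ae mu, forall t, A 0 t = 0}.
Proof.
apply: filterS (A_linear 1 0 0) => t; rewrite scaler0 addr0 mul1r => A0.
by apply: (addrI (A 0 t)); rewrite -A0 addr0.
Qed.

Lemma ae_linearZ k x : {ae mu, forall t, A (k *: x) t = k * A x t}.
Proof.
by apply: filterS2 ae_linear0 (A_linear k x 0) => t A0; rewrite addr0 A0 addr0.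
Qed.

Lemma ae_linearD x y : {ae mu, forall t, A (x + y) t = A x t + A y t}.
Proof.
by apply: filterS (A_linear 1 x y) => t; rewrite scale1r mul1r.
Qed.

Variable C : set T.
Hypothesis C_nonnull : ~ {ae mu, forall t, ~ C t}.

Definition upper_bounds (x : X) : set R :=
  [set r | {ae mu, forall t, C t -> scalar_re (A x t) <= r}].

Lemma upper_bounds_norm x : upper_bounds x (a * rnorm x).
Proof.
apply: filterS (A_bounded x) => t At _; exact: le_trans (re_le_modulus _) At.
Qed.

Lemma upper_bounds_ge x r : upper_bounds x r -> - (a * rnorm x) <= r.
Proof.
move=> xr; rewrite leNgt; apply/negP => r_lt; apply: C_nonnull.
apply: filterS2 xr (A_bounded x) => t tr ta Ct.
have := tr Ct; have := le_trans (modulus_re_le (A x t)) ta.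
by rewrite ler_norml => /andP[]; lra.
Qed.

Definition upper_value (x : X) : R := inf (upper_bounds x).

Lemma upper_value_le x r : upper_bounds x r -> upper_value x <= r.
Proof.
by move=> xr; apply: ge_inf => //; exists (- (a * rnorm x)) => ? /upper_bounds_ge.
Qed.

Lemma upper_value_sublinear : sublinear upper_value.
Proof.
have nonempty x : upper_bounds x !=set0 by eexists; exact: upper_bounds_norm.
split=> [x y|c x c0].
  apply: le_add_inf => // r r' xr yr'; apply: upper_value_le.
  near=> t; move=> Ct.
  have -> : A (x + y) t = A x t + A y t by near: t; exact: ae_linearD.
  rewrite scalar_reD; apply: lerD; move: Ct; near: t; [exact: xr|exact: yr'].
apply: le_mul_inf => // r xr; apply: upper_value_le.
apply: filterS2 xr (ae_linearZ c%:S x) => t tr -> Ct.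
by rewrite scalar_reZ ler_wpM2l// tr.
Unshelve. all: by end_near. Qed.

(** The essential supremum over [C] of the real part of [A x] is sublinear in
    [x]; a linear form below it lies between the essential infimum and the
    essential supremum for every [x]. It replaces evaluation at a point of
    [C], which makes no sense for classes of functions, and averaging over [C],
    which makes no sense when [C] has infinite measure. *)
Lemma cell_functional : exists psi : dual X,
  (forall x, modulus (psi x) <= a * rnorm x) /\
  forall (x : X) (k : K) (e : R),
    {ae mu, forall t, C t -> `|scalar_re (A x t - k)| <= e /\ `|scalar_im (A x t - k)| <= e} ->
    modulus (psi x - k) <= e + e.
Proof.
have [l [llin lle _]] := Hahn_Banach_sublinear 0 upper_value_sublinear.
have lbnd x : l x <= a * rnorm x.
  by apply: le_trans (lle x) _; exact/upper_value_le/upper_bounds_norm.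
have [psi psiE] := dual_of_real_linear llin a_ge0 lbnd.
have psi_re x r : upper_bounds x r -> scalar_re (psi x) <= r.
  by move=> xr; rewrite psiE; apply: le_trans (lle x) (upper_value_le xr).
have psi_near x k e :
    {ae mu, forall t, C t -> `|scalar_re (A x t - k)| <= e} ->
    `|scalar_re (psi x - k)| <= e.
  move=> Axk; rewrite ler_norml scalar_reB; apply/andP; split.
    have : upper_bounds ((-1 : K) *: x) (e - scalar_re k).
      apply: filterS2 Axk (ae_linearZ (-1) x) => t tk -> /tk.
      by rewrite mulN1r scalar_reN scalar_reB ler_norml => /andP[]; lra.
    by move/psi_re; rewrite dualZ mulN1r scalar_reN; lra.
  have : upper_bounds x (e + scalar_re k).
    by apply: filterS Axk => t tk /tk; rewrite scalar_reB ler_norml => /andP[]; lra.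
  by move/psi_re; lra.
exists psi; split.
  by apply: modulus_le_of_re => // x; rewrite psiE.
move=> x k e Axk; apply: le_trans (modulus_le_re_im _) _; apply: lerD.
  by apply: psi_near; apply: filterS Axk => t tk /tk[].
have imE z : `|scalar_im z| = `|scalar_re (imag_unit R s * z)|.
  by rewrite scalar_re_imag normrN.
rewrite imE mulrBr -dualZ; apply: psi_near.
apply: filterS2 Axk (ae_linearZ (imag_unit R s) x) => t tk -> /tk[_].
by rewrite -mulrBr imE.
Qed.

End CellFunctional.

(** * Operator norms are attained bounds *)

Section OperatorNorms.
Context (R : realType) (s : scalars).
Local Notation K := (scalar_field R s).
Local Notation "r %:S" := (scalar_of_real s r) (at level 2, format "r %:S").

Lemma inf_bound (I : Type) (P : I -> Prop) (g h : I -> R) :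
  (forall i, P i -> 0 <= h i) ->
  (exists c, 0 <= c /\ forall i, P i -> g i <= c * h i) ->
  forall i, P i -> g i <= inf [set c | 0 <= c /\ forall i, P i -> g i <= c * h i] * h i.
Proof.
move=> h0 [c cP] i Pi; rewrite mulrC; apply: le_mul_inf; [by exists c|exact: h0|].
by move=> r [_ /(_ i Pi)]; rewrite mulrC.
Qed.

Lemma inf_nonneg (A : set R) : (forall c, A c -> 0 <= c) -> 0 <= inf A.
Proof.
move=> A0; have [->|/set0P A_neq0] := eqVneq A set0; first by rewrite inf0.
exact: lb_le_inf.
Qed.

Context d (T : measurableType d) (mu : {measure set T -> \bar R}).
Context (E : normedModType K) (p : \bar R).

Lemma Lp_norm_fineK (f : T -> K) : (Lp_norm mu p f < +oo)%E ->
  ((fine (Lp_norm mu p f))%:E = Lp_norm mu p f)%E.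
Proof. by move=> foo; rewrite fineK// ge0_fin_numE// Lnorm_ge0. Qed.

Lemma norm_into_Lp_ge0 (A : E -> T -> K) : 0 <= norm_into_Lp mu p A.
Proof. by apply: inf_nonneg => c []. Qed.

Lemma norm_from_Lp_ge0 (B : (T -> K) -> E) : 0 <= norm_from_Lp mu p B.
Proof. by apply: inf_nonneg => c []. Qed.

Lemma norm_into_Lp_le (A : E -> T -> K) c : 0 <= c ->
  (forall x, (Lp_norm mu p (A x) <= (c * rnorm x)%:E)%E) ->
  norm_into_Lp mu p A <= c.
Proof. by move=> c0 Ac; apply: ge_inf; [exists 0 => ? []|split]. Qed.

Lemma norm_from_Lp_le (B : (T -> K) -> E) c : 0 <= c ->
  (forall f, in_Lp mu p f -> ((rnorm (B f))%:E <= c%:E * Lp_norm mu p f)%E) ->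
  norm_from_Lp mu p B <= c.
Proof. by move=> c0 Bc; apply: ge_inf; [exists 0 => ? []|split]. Qed.

Lemma norm_into_Lp_bound (A : E -> T -> K) : bounded_into_Lp mu p A ->
  forall x, (Lp_norm mu p (A x) <= (norm_into_Lp mu p A * rnorm x)%:E)%E.
Proof.
move=> [inA _ [c Ac]] x.
have fin y : (fine (Lp_norm mu p (A y)))%:E = Lp_norm mu p (A y).
  by apply: Lp_norm_fineK; have [] := inA y.
have := @inf_bound E xpredT (fun y => fine (Lp_norm mu p (A y))) (fun y => rnorm y)
  (fun y _ => rnorm_ge0 y).
have ex : exists c, 0 <= c /\ forall y, true -> fine (Lp_norm mu p (A y)) <= c * rnorm y.
  exists `|c|; split=> // y _; rewrite -lee_fin fin; apply: le_trans (Ac y) _.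
  by rewrite lee_fin ler_wpM2r ?rnorm_ge0// ler_norm.
move=> /(_ ex x isT); rewrite -lee_fin fin => /le_trans; apply.
rewrite lee_fin ler_wpM2r ?rnorm_ge0// le_eqVlt; apply/orP; left; apply/eqP.
congr inf; apply/seteqP; split => r [r0 rA]; split=> //.
  by move=> y; rewrite -fin lee_fin; exact: rA.
by move=> y _; rewrite -lee_fin fin.
Qed.

Lemma norm_from_Lp_bound (B : (T -> K) -> E) : bounded_from_Lp mu p B ->
  forall f, in_Lp mu p f ->
    ((rnorm (B f))%:E <= (norm_from_Lp mu p B)%:E * Lp_norm mu p f)%E.
Proof.
move=> [_ [c Bc]] f inf.
have fin (g : T -> K) : in_Lp mu p g -> (fine (Lp_norm mu p g))%:E = Lp_norm mu p g.
  by move=> [_ _ goo]; exact: Lp_norm_fineK goo.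
have fin0 (g : T -> K) : 0 <= fine (Lp_norm mu p g) by apply: fine_ge0; exact: Lnorm_ge0.
have := @inf_bound _ (fun g : T -> K => in_Lp mu p g)
  (fun g => rnorm (B g)) (fun g => fine (Lp_norm mu p g))
  (fun g _ => fin0 g).
have ex : exists c, 0 <= c /\ forall g, in_Lp mu p g -> rnorm (B g) <= c * fine (Lp_norm mu p g).
  exists `|c|; split=> // g ing; rewrite -lee_fin EFinM fin//; apply: le_trans (Bc g ing) _.
  by rewrite lee_wpmul2r ?Lnorm_ge0// lee_fin ler_norm.
move=> /(_ ex f inf); rewrite -lee_fin EFinM fin// => /le_trans; apply.
rewrite lee_wpmul2r ?Lnorm_ge0// lee_fin le_eqVlt; apply/orP; left; apply/eqP.
congr reals.inf; apply/seteqP; split => r [r0 rB]; split=> // g ing.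
  by rewrite -fin// -EFinM lee_fin; exact: rB.
by rewrite -lee_fin EFinM fin//; exact: rB.
Qed.

End OperatorNorms.

(** * Step functions over a finite partition *)

Section StepFunctions.
Context (R : realType) (s : scalars).
Local Notation K := (scalar_field R s).
Local Notation "r %:S" := (scalar_of_real s r) (at level 2, format "r %:S").
Context d (T : measurableType d) (mu : {measure set T -> \bar R}) (p : \bar R).
Hypothesis p_ge1 : (1%:E <= p)%E.
Hypothesis mu_prob : (p < +oo)%E -> mu [set: T] = 1%E.
Context (Bt : finType) (q : {mfun T >-> atoms Bt}).
Local Notation I := (atoms Bt).
Implicit Types (f g : I -> K).

Lemma scalar_measurable_atoms f : scalar_measurable (f : I -> K).
Proof. by split. Qed.

Lemma scalar_measurable_step f : scalar_measurable (fun t => f (q t)).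
Proof.
have [fr fi] := scalar_measurable_atoms f.
by split; [apply: (measurableT_comp fr)|apply: (measurableT_comp fi)].
Qed.

Definition step_norm f : R := fine (Lp_norm mu p (fun t => f (q t))).

Lemma Lp_norm_step_le f : (Lp_norm mu p (fun t => f (q t)) <= (\sum_i modulus (f i))%:E)%E.
Proof.
have M0 : 0 <= \sum_i modulus (f i) by apply: sumr_ge0 => i _; exact: modulus_ge0.
rewrite -[X in (_ <= X%:E)%E](ger0_norm M0) -(modulus_of_real s).
apply: le_trans (Lp_norm_cst_le _ p_ge1 mu_prob).
apply: le_Lp_norm => //; first exact: scalar_measurable_step.
apply: nearW => t; rewrite modulus_of_real ger0_norm// (bigD1 (q t))//= lerDl.
by apply: sumr_ge0 => i _; exact: modulus_ge0.
Qed.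

Lemma in_Lp_step f : in_Lp mu p (fun t => f (q t)).
Proof.
have [? ?] := scalar_measurable_step f; split=> //.
exact: le_lt_trans (Lp_norm_step_le f) (ltry _).
Qed.

Lemma step_normE f : Lp_norm mu p (fun t => f (q t)) = (step_norm f)%:E.
Proof. by rewrite /step_norm Lp_norm_fineK//; have [] := in_Lp_step f. Qed.

Lemma step_norm_ge0 f : 0 <= step_norm f.
Proof. by apply: fine_ge0; exact: Lnorm_ge0. Qed.

Lemma le_step_norm f g : (forall i, modulus (f i) <= modulus (g i)) ->
  step_norm f <= step_norm g.
Proof.
move=> fg; rewrite -lee_fin -!step_normE.
apply: le_Lp_norm => //; [exact: scalar_measurable_step..|exact: nearW].
Qed.

Lemma step_normZ k f : step_norm (fun i => k * f i) = modulus k * step_norm f.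
Proof.
apply: EFin_inj; rewrite EFinM -!step_normE.
exact: (Lp_normZ mu k p_ge1 (scalar_measurable_step f)).
Qed.

Definition weight (i : I) : R := step_norm (fun i' => if i' == i then 1 else 0).

Lemma weight_ge0 i : 0 <= weight i.
Proof. exact: step_norm_ge0. Qed.

Lemma modulus_weight_le f i : modulus (f i) * weight i <= step_norm f.
Proof.
rewrite -step_normZ; apply: le_step_norm => i'; case: eqP => [->|_].
  by rewrite mulr1.
by rewrite mulr0 modulus0 modulus_ge0.
Qed.

Lemma weight_eq0_ae i : weight i = 0 -> {ae mu, forall t, q t != i}.
Proof.
move=> wi0; pose f i' : K := if i' == i then 1 else 0.
have : {ae mu, forall t, f (q t) = 0}.
  apply: (Lp_norm_eq0_ae p_ge1 (scalar_measurable_step f)).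
  by rewrite step_normE; congr EFin.
apply: filterS => t; rewrite /f; case: eqP => // _ /eqP.
by rewrite oner_eq0.
Qed.

Lemma weight_neq0_nonnull i : weight i != 0 -> ~ {ae mu, forall t, ~ q t = i}.
Proof.
move=> wi0 null; move/eqP: wi0; apply; apply/eqP; rewrite eq_le weight_ge0 andbT.
rewrite -lee_fin -step_normE.
apply: (le_trans (y := Lp_norm mu p (fun=> 0 : K))); last first.
  by rewrite (le_trans (Lp_norm_cst_le _ p_ge1 mu_prob))// modulus0.
apply: le_Lp_norm => //.
  exact: (scalar_measurable_step (fun i' => if i' == i then 1 else 0)).
by apply: filterS null => t /eqP/negbTE->.
Qed.

End StepFunctions.

(** * Finite rank approximation of a factorization *)

Section FiniteRankApproximation.
Context (R : realType) (s : scalars).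
Local Notation K := (scalar_field R s).
Local Notation "r %:S" := (scalar_of_real s r) (at level 2, format "r %:S").

Lemma bounded_linear_continuous_rnorm (E F : normedModType K) (f : {linear E -> F}) (c : R) :
  0 <= c -> (forall x, rnorm (f x) <= c * rnorm x) -> continuous f.
Proof.
move=> c0 fc; apply: bounded_linear_continuous; apply/linear_boundedP.
exists c%:S; split=> [|r cr x].
  by apply: ger0_real; rewrite -(scalar_of_real0 R s) ler_scalar_of_real.
rewrite (le_trans (y := c%:S * `|x|))//; last by rewrite ler_wpM2r// ltW.
by rewrite -!rnormE -scalar_of_realM ler_scalar_of_real.
Qed.

Lemma canonical_inclusion_linear (E : normedModType K) (k : K) (x y : E) :
  canonical_inclusion (k *: x + y) = k *: canonical_inclusion x + canonical_inclusion y.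
Proof. by apply: dual_eq => f; rewrite dual_addE dual_scaleE /= dualD dualZ. Qed.

Lemma rnorm_canonical_inclusion_le (E : normedModType K) (x : E) :
  rnorm (canonical_inclusion x) <= rnorm x.
Proof.
rewrite rnorm_dual; apply: dual_rnorm_le => [|f]; first exact: rnorm_ge0.
by rewrite /= rnorm_dual mulrC dual_rnorm_bound.
Qed.

Context (p : \bar R) (hp : (1%:E <= p)%E).
Context (X Y : normedModType K) (T : X -> Y).
Context d (S : measurableType d) (mu : {measure set S -> \bar R}).
Context (A : X -> S -> K) (B : (S -> K) -> dual (dual Y)) (a b : R).
Hypothesis mu_prob : (p < +oo)%E -> mu [set: S] = 1%E.
Hypothesis A_inLp : forall x, in_Lp mu +oo (A x).
Hypothesis A_linear : forall (k : K) x y,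
  {ae mu, forall t, A (k *: x + y) t = k * A x t + A y t}.
Hypothesis a_ge0 : 0 <= a.
Hypothesis A_bounded : forall x, (Lp_norm mu +oo (A x) <= (a * rnorm x)%:E)%E.
Hypothesis B_linear : forall (k : K) f g, in_Lp mu p f -> in_Lp mu p g ->
  B (fun t => k * f t + g t) = k *: B f + B g.
Hypothesis b_ge0 : 0 <= b.
Hypothesis B_bounded : forall f, in_Lp mu p f ->
  ((rnorm (B f))%:E <= b%:E * Lp_norm mu p f)%E.
Hypothesis T_factor : forall x, canonical_inclusion (T x) = B (A x).

Let A_ae x : {ae mu, forall t, modulus (A x t) <= a * rnorm x}.
Proof. exact: Lp_norm_pinfty_ae. Qed.

Let A_meas x : scalar_measurable (A x).
Proof. by have [] := A_inLp x. Qed.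

Lemma Lp_norm_le_ae (f : S -> K) c : scalar_measurable f -> 0 <= c ->
  {ae mu, forall t, modulus (f t) <= c} -> (Lp_norm mu p f <= c%:E)%E.
Proof.
move=> mf c0 fc; rewrite -(ger0_norm c0) -(modulus_of_real s).
apply: le_trans (Lp_norm_cst_le _ hp mu_prob).
by apply: le_Lp_norm => //; rewrite modulus_of_real ger0_norm.
Qed.

Let A_inLp_p x : in_Lp mu p (A x).
Proof.
have [? ?] := A_meas x; split=> //.
apply: le_lt_trans (ltry (a * rnorm x)).
by apply: Lp_norm_le_ae => //; rewrite mulr_ge0 ?rnorm_ge0.
Qed.

Section Discretization.
Context (Bt : finType) (q : {mfun S >-> atoms Bt}).
Local Notation I := (atoms Bt).
Local Notation w := (@weight R s _ _ mu p _ q).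
Local Notation N := (@step_norm R s _ _ mu p _ q).

Lemma factor_step0 : B (fun=> 0) = 0.
Proof.
have in0 := in_Lp_step hp mu_prob q (fun=> 0 : K).
have := B_linear 1 in0 in0; rewrite mulr0 addr0 scale1r => B0.
by apply: (addrI (B (fun=> 0))); rewrite -B0 addr0.
Qed.

(** The image under [B] of the normalized indicator of an atom; the image is
    [0] for an atom of weight [0], by the convention on the inverse of 0. *)
Definition atom_vector (i : I) : dual (dual Y) :=
  B (fun t => if q t == i then (w i)^-1%:S else 0).

Lemma sum_atom_vector (c : I -> K) :
  \sum_i c i *: atom_vector i = B (fun t => c (q t) * (w (q t))^-1%:S).
Proof.
pose e i i' : K := if i' == i then (w i)^-1%:S else 0.
have sumE (r : seq I) : B (fun t => \sum_(i <- r) c i * e i (q t)) =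
    \sum_(i <- r) c i *: atom_vector i.
  elim: r => [|i r IH].
    by rewrite big_nil -factor_step0; congr B; apply/funext => t; rewrite big_nil.
  rewrite big_cons -IH -B_linear; last 2 first.
  - exact: (in_Lp_step hp mu_prob q (e i)).
  - exact: (in_Lp_step hp mu_prob q (fun i' => \sum_(j <- r) c j * e j i')).
  by congr B; apply/funext => t; rewrite big_cons.
rewrite -sumE; congr B; apply/funext => t.
rewrite (bigD1 (q t))//= /e eqxx big1 ?addr0// => i.
by rewrite eq_sym => /negbTE->; rewrite mulr0.
Qed.

Lemma rnorm_factor_step (f : I -> K) : rnorm (B (fun t => f (q t))) <= b * N f.
Proof.
rewrite -lee_fin EFinM -step_normE//.
by apply: B_bounded; exact: in_Lp_step.
Qed.

Lemma ae_weight_neq0 : {ae mu, forall t, w (q t) != 0}.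
Proof.
have : {ae mu, forall t, forall i : I, w i = 0 -> q t != i}.
  apply: filter_forall => i; have [/weight_eq0_ae wi|wi] := eqVneq (w i) 0.
    by apply: filterS (wi hp mu_prob) => t.
  by apply: nearW => t wi0; rewrite wi0 eqxx in wi.
by apply: filterS => t qt; apply/eqP => /qt; rewrite eqxx.
Qed.

(** The factor [w i / w i] is [1] except on atoms of weight zero, which are
    negligible together. *)
Lemma factor_step_sum (f : I -> K) :
  \sum_i (f i * (w i)%:S) *: atom_vector i = B (fun t => f (q t)).
Proof.
rewrite (sum_atom_vector (fun i => f i * (w i)%:S)).
set g := fun i => f i * (w i)%:S * (w i)^-1%:S.
have := B_linear (-1) (in_Lp_step hp mu_prob q f) (in_Lp_step hp mu_prob q g).
rewrite scaleN1r => diff; apply/eqP; rewrite -subr_eq0 addrC -diff; apply/eqP/rnorm_eq0.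
apply/eqP; rewrite eq_le rnorm_ge0 andbT -lee_fin.
pose h i := -1 * f i + g i.
apply: le_trans (B_bounded (in_Lp_step hp mu_prob q h)) _.
rewrite -[leRHS](mule0 b%:E); apply: lee_wpmul2l; first by rewrite lee_fin.
apply: Lp_norm_le_ae => //; first exact: scalar_measurable_step.
apply: filterS ae_weight_neq0 => t wt.
rewrite /h /g -mulrA -scalar_of_realM mulfV// scalar_of_real1 mulr1 mulN1r addNr.
by rewrite modulus0.
Qed.

(** The operator induced by [B] on step functions takes its values in the
    bidual; local reflexivity moves them to [Y], at the cost of [delta].
    Only finitely many inequalities can be prescribed, so the bound on the norm
    is imposed on the points of a grid that lie in the unit ball. Normalized
    indicators belong to this grid, which bounds every [v i] and hence the
    error made by rounding a vector of the unit ball to the grid. *)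
Lemma lift_factor_step (m : nat) (c : 'I_m -> I -> K) (y : 'I_m -> Y) (e delta : R) :
  0 <= e -> 0 < delta ->
  (forall k, rnorm (B (fun t => c k (q t)) - canonical_inclusion (y k)) <= e) ->
  exists v : I -> Y,
    (forall f : I -> K,
       rnorm (\sum_i (f i * (w i)%:S) *: v i) <= (b + delta) * (1 + delta) * N f) /\
    forall k, rnorm (\sum_i (c k i * (w i)%:S) *: v i - y k) <= e + delta.
Proof.
move=> e0 delta0 cy.
have card0 : 0 < #|{: I}|.+1%:R :> R by rewrite ltr0n.
have [D [D0 D1 DP]] := scalar_grid s (divr_gt0 delta0 card0).
pose coef (g : {ffun I -> seq_sub D}) i : K := ssval (g i).
pose small (g : I -> K) : bool := N (fun i => g i * (w i)^-1%:S) <= 1.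
pose M (j : {ffun I -> seq_sub D} + 'I_m) (i : I) : K :=
  match j with
  | inl g => if small (coef g) then coef g i else 0
  | inr k => c k i * (w i)%:S
  end.
pose r (j : {ffun I -> seq_sub D} + 'I_m) : R := if j is inl _ then b else e.
pose z (j : {ffun I -> seq_sub D} + 'I_m) : Y := if j is inr k then y k else 0.
have J0 : canonical_inclusion (0 : Y) = 0.
  by apply: dual_eq => f; rewrite /= dual0.
have [|||v vP] := @local_reflexivity R s Y I _ M (fun j => r j + delta) _
    atom_vector z r.
- by move=> [g|k]; rewrite /r ltr_wpDl.
- by move=> [g|k]; rewrite /r ltrDl delta0 ?b_ge0 ?e0.
- move=> [g|k]; last by rewrite factor_step_sum; exact: cy.
  rewrite /z J0 subr0 /M /r.
  case g1: (small (coef g)); last first.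
    by rewrite big1 ?rnorm0// => i _; rewrite scale0r.
  rewrite (sum_atom_vector (coef g)).
  apply: le_trans (rnorm_factor_step (fun i => coef g i * (w i)^-1%:S)) _.
  by rewrite ler_piMr.
exists v; split=> [f|k]; last first.
  by apply: ltW; exact: (vP (inr k)).
have v_grid (g : I -> K) : (forall i, g i \in D) -> small g ->
    rnorm (\sum_i g i *: v i) <= b + delta.
  move=> gD g1; pose g' : {ffun I -> seq_sub D} := [ffun i => SeqSub (gD i)].
  have gE : coef g' = g by apply/funext => i; rewrite /coef ffunE.
  have := vP (inl g'); rewrite /M /z /r gE g1 subr0; exact: ltW.
have v_le i : rnorm (v i) <= b + delta.
  have := v_grid (fun i' => if i' == i then 1 else 0).
  rewrite (bigD1 i)//= eqxx scale1r big1 ?addr0; last first.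
    by move=> i' /negbTE->; rewrite scale0r.
  apply; first by move=> i'; case: ifP.
  rewrite /small.
  apply: (@le_trans _ _ (N (fun i' => (w i)^-1%:S * (if i' == i then 1 else 0)))).
    apply: le_step_norm => // i'; case: eqP => [->|_]; first by rewrite mul1r mulr1.
    by rewrite mul0r mulr0.
  rewrite step_normZ// modulus_of_real ger0_norm ?invr_ge0 ?weight_ge0//.
  rewrite -/(w i); have [->|wi] := eqVneq (w i) 0; first by rewrite mulr0 ler01.
  by rewrite mulVf.
have bd0 : 0 <= b + delta by rewrite addr_ge0// ltW.
have fw_le i : modulus (f i * (w i)%:S) <= N f.
  rewrite modulusM modulus_of_real ger0_norm ?weight_ge0//.
  exact: modulus_weight_le.
have [Nf0|Nf0] := eqVneq (N f) 0.
  rewrite Nf0 mulr0 big1 ?rnorm0// => i _.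
  rewrite (_ : f i * _ = 0) ?scale0r//; apply: modulus_eq0; apply/eqP.
  by rewrite eq_le modulus_ge0 andbT -Nf0.
have Nf_gt0 : 0 < N f by rewrite lt_def Nf0 step_norm_ge0.
pose k i := (N f)^-1%:S * (f i * (w i)%:S).
have k1 i : modulus (k i) <= 1.
  rewrite modulusM modulus_of_real ger0_norm ?invr_ge0 ?step_norm_ge0//.
  by rewrite ler_pdivrMl// mulr1.
have gex i : exists g, g \in D /\ modulus g <= modulus (k i) /\
    modulus (k i - g) <= delta / #|{: I}|.+1%:R.
  by have [g gD gk] := DP _ (k1 i); exists g.
have [g gP] := choice gex.
have g_small : small g.
  rewrite /small -[leRHS](mulVf Nf0) -[X in X * N f]ger0_norm; last first.
    by rewrite invr_ge0 step_norm_ge0.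
  rewrite -(modulus_of_real s) -step_normZ//; apply: le_step_norm => // i.
  rewrite modulusM (le_trans (ler_wpM2r (modulus_ge0 _) (gP i).2.1))//.
  rewrite !modulusM -!mulrA ler_wpM2l ?modulus_ge0// ler_piMr ?modulus_ge0//.
  rewrite -modulusM -scalar_of_realM modulus_of_real.
  have [->|wi] := eqVneq (w i) 0; first by rewrite mul0r normr0 ler01.
  by rewrite mulfV// normr1.
have -> : \sum_i (f i * (w i)%:S) *: v i =
    (N f)%:S *: (\sum_i g i *: v i + \sum_i (k i - g i) *: v i).
  rewrite -big_split/= scaler_sumr; apply: eq_bigr => i _.
  rewrite -scalerDl scalerA addrC subrK /k mulrA -scalar_of_realM mulfV//.
  by rewrite scalar_of_real1 mul1r.
rewrite rnormZ modulus_of_real ger0_norm ?step_norm_ge0// mulrC.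
apply: ler_wpM2r; first exact: step_norm_ge0.
rewrite mulrDr mulr1; apply: le_trans (rnormD _ _) (lerD _ _).
  by apply: v_grid => // i; exact: (gP i).1.
apply: le_trans (rnorm_sum _) _.
apply: (@le_trans _ _ (\sum_(i : I) (delta / #|{: I}|.+1%:R) * (b + delta))).
  apply: ler_sum => i _; rewrite rnormZ ler_pM ?modulus_ge0 ?rnorm_ge0//.
  exact: (gP i).2.2.
rewrite sumr_const -[leLHS]mulr_natl mulrA mulrC ler_wpM2l//.
rewrite mulrCA ler_piMr ?(ltW delta0)// ler_pdivrMr// mul1r ler_nat.
exact: leqnSn.
Qed.

(** One functional per atom discretizes all the [A x] at once: linearly in
    [x], without increasing the bound [a], and within twice the oscillation of
    [A x] on the atoms. *)
Lemma atom_functionals : exists psi : I -> dual X,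
  (forall i x, modulus (psi i x) <= a * rnorm x) /\
  forall x e,
    (forall t t', q t = q t' -> modulus (A x t) <= a * rnorm x ->
      modulus (A x t') <= a * rnorm x ->
      `|scalar_re (A x t - A x t')| <= e /\ `|scalar_im (A x t - A x t')| <= e) ->
    {ae mu, forall t, modulus (psi (q t) x - A x t) <= e + e}.
Proof.
have ex i : exists psi : dual X, (forall x, modulus (psi x) <= a * rnorm x) /\
    (w i != 0 -> forall x k e,
      {ae mu, forall t, q t = i ->
        `|scalar_re (A x t - k)| <= e /\ `|scalar_im (A x t - k)| <= e} ->
      modulus (psi x - k) <= e + e).
  have [wi|wi] := eqVneq (w i) 0.
    exists 0; split=> // x; rewrite (_ : (0 : dual X) x = 0)// modulus0.
    by rewrite mulr_ge0 ?rnorm_ge0.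
  have [psi [psi1 psi2]] := cell_functional A_linear a_ge0 A_ae
    (C := [set t | q t = i]) (weight_neq0_nonnull hp mu_prob wi).
  by exists psi; split=> // _; exact: psi2.
have [psi psiP] := choice ex; exists psi; split=> [i|x e osc]; first exact: (psiP i).1.
apply: filterS2 ae_weight_neq0 (A_ae x) => t wt At.
apply: (psiP (q t)).2 => //; apply: filterS (A_ae x) => t' At' qt'.
exact: osc.
Qed.

(** Over the finite space of atoms, with the image measure, this is again a
    factorization of the kind required: every function there is a step function,
    so no projection onto the step functions is needed. *)
Lemma atomic_operator (psi : I -> dual X) (v : I -> Y) (b' : R) : 0 <= b' ->
  (forall i x, modulus (psi i x) <= a * rnorm x) ->
  (forall f : I -> K, rnorm (\sum_i (f i * (w i)%:S) *: v i) <= b' * N f) ->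
  exists T' : {linear X -> Y}, [/\ continuous T', finite_rank T', p_integral p T',
    (p_integral_norm p T' <= (a * b')%:E)%E &
    forall x, T' x = \sum_i (psi i x * (w i)%:S) *: v i].
Proof.
move=> b'0 psia vb.
pose f x := \sum_i (psi i x * (w i)%:S) *: v i.
have lf : linear f.
  move=> k x y; rewrite /f scaler_sumr -big_split/=; apply: eq_bigr => i _.
  by rewrite dualD dualZ mulrDl scalerDl -mulrA scalerA.
pose T' : {linear X -> Y} := HB.pack f (GRing.isLinear.Build _ _ _ _ f lf).
pose nu : {measure set I -> \bar R} := image_measure mu q.
pose A' (x : X) (i : I) : K := psi i x.
pose B' (g : I -> K) : dual (dual Y) :=
  canonical_inclusion (\sum_i (g i * (w i)%:S) *: v i).
have nu_prob : (p < +oo)%E -> nu setT = 1%E.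
  by move=> /mu_prob <-; exact: image_measureT.
have A'a x : (Lp_norm nu +oo (A' x) <= (a * rnorm x)%:E)%E.
  have ax0 : 0 <= a * rnorm x by rewrite mulr_ge0 ?rnorm_ge0.
  apply: (@le_trans _ _ (Lp_norm nu +oo (fun=> (a * rnorm x)%:S : K))); last first.
    rewrite -[in leRHS](ger0_norm ax0) -(modulus_of_real s).
    by apply: Lp_norm_cst_le; rewrite ?leey.
  apply: le_Lp_norm; rewrite ?leey//; apply: nearW => i.
  by rewrite modulus_of_real ger0_norm//; exact: psia.
have B'E g : Lp_norm nu p g = (N g)%:E.
  by rewrite [LHS](Lp_norm_image_measure mu q hp (scalar_measurable_atoms g)) step_normE.
have B'b g : ((rnorm (B' g))%:E <= b'%:E * Lp_norm nu p g)%E.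
  rewrite B'E -EFinM lee_fin; apply: le_trans (vb g).
  exact: rnorm_canonical_inclusion_le.
have fact : p_integral_factorization p T' nu A' B'.
  split=> //.
  - split=> [x|k x y|]; last by exists a.
      by split=> //; exact: le_lt_trans (A'a x) (ltry _).
    by apply: nearW => i; rewrite /A' dualD dualZ.
  - split=> [k g h _ _|]; last by exists b' => g _; exact: B'b.
    rewrite /B' -canonical_inclusion_linear; congr canonical_inclusion.
    rewrite scaler_sumr -big_split/=; apply: eq_bigr => i _.
    by rewrite mulrDl scalerDl -mulrA scalerA.
exists T'; split=> //.
- apply: (@bounded_linear_continuous_rnorm _ _ _ (\sum_i a * w i * rnorm (v i))).
    apply: sumr_ge0 => i _.
    by rewrite mulr_ge0 ?rnorm_ge0// mulr_ge0// weight_ge0.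
  move=> x; apply: le_trans (rnorm_sum _) _; rewrite mulr_suml; apply: ler_sum => i _.
  rewrite rnormZ modulusM modulus_of_real ger0_norm ?weight_ge0//.
  rewrite [leRHS]mulrAC ler_wpM2r ?rnorm_ge0// [leRHS]mulrAC.
  by rewrite ler_wpM2r ?weight_ge0.
- exists #|{: I}|, (fun j => v (enum_val j)) => x.
  exists (fun j => psi (enum_val j) x * (w (enum_val j))%:S).
  exact: (big_enum_val (A := {: I}) (fun i => (psi i x * (w i)%:S) *: v i)).
- by exists _, _, nu, A', B'.
- apply: (@le_trans _ _ (norm_into_Lp nu +oo A' * norm_from_Lp nu p B')%:E).
    by apply: ereal_inf_lbound; exists _, _, nu, A', B'.
  rewrite lee_fin ler_pM ?norm_into_Lp_ge0 ?norm_from_Lp_ge0//.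
    exact: norm_into_Lp_le.
  by apply: norm_from_Lp_le => // g _; exact: B'b.
Qed.

End Discretization.

(** Discretize [A] by a partition on which the [A (x k)] oscillate little, and
    lift to [Y] the restriction of [B] to the step functions. At [x k] the
    discretized operator is close to [canonical_inclusion (T (x k))], so the
    lifting can be asked to send it close to [T (x k)] itself. *)
Lemma finite_rank_approximation (m : nat) (x : 'I_m -> X) (theta : R) : 0 < theta ->
  exists T' : {linear X -> Y}, [/\ continuous T', finite_rank T', p_integral p T',
    (p_integral_norm p T' <= (a * (b + theta))%:E)%E &
    forall k, rnorm (T' (x k) - T (x k)) <= theta].
Proof.
move=> theta0.
have b3 : 0 < b + 3 by rewrite ltr_wpDl.
have [delta [delta0 delta1 delta2]] : exists delta : R,
    [/\ 0 < delta, delta <= 1 & delta * (b + 3) <= theta].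
  (* [b + 3] makes both [(b + delta) * (1 + delta) <= b + theta] and
     [delta <= theta / 2] hold *)
  exists (Num.min 1 (theta / (b + 3))); split.
  - by rewrite lt_min ltr01 divr_gt0.
  - by rewrite ge_min lexx.
  - by rewrite -ler_pdivlMr// ge_min lexx orbT.
(* chosen so that [b * (eps + eps) <= theta / 2] *)
pose eps := theta / (4 * (b + 1)).
have b1 : 0 < b + 1 by rewrite ltr_wpDl.
have eps0 : 0 < eps by rewrite divr_gt0// mulr_gt0.
have epsE : eps * (4 * (b + 1)) = theta by rewrite divfK// gt_eqF// mulr_gt0.
pose M := \sum_k a * rnorm (x k).
have xM k : a * rnorm (x k) <= M.
  rewrite /M (bigD1 k)//= lerDl sumr_ge0// => j _.
  by rewrite mulr_ge0 ?rnorm_ge0.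
pose g (j : 'I_m * bool) t :=
  if j.2 then scalar_re (A (x j.1) t) else scalar_im (A (x j.1) t).
have mg j : measurable_fun setT (g j).
  by case: j => k [] /=; have [] := A_meas (x k).
have [Bt [q osc]] := finite_oscillation M mg eps0.
have [psi [psia psiA]] := atom_functionals q.
have psi_near k : {ae mu, forall t, modulus (psi (q t) (x k) - A (x k) t) <= eps + eps}.
  apply: psiA => t t' qtt' tM t'M; split.
    have := osc (k, true) t t' qtt'; rewrite /g /= scalar_reB; apply.
      exact: le_trans (modulus_re_le _) (le_trans tM (xM k)).
    exact: le_trans (modulus_re_le _) (le_trans t'M (xM k)).
  have := osc (k, false) t t' qtt'; rewrite /g /= scalar_imB; apply.
    exact: le_trans (modulus_im_le _) (le_trans tM (xM k)).
  exact: le_trans (modulus_im_le _) (le_trans t'M (xM k)).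
have close k : rnorm (B (fun t => psi (q t) (x k)) - canonical_inclusion (T (x k)))
    <= b * (eps + eps).
  have inpsi := in_Lp_step hp mu_prob q (fun i => psi i (x k)).
  have := B_linear (-1) (A_inLp_p (x k)) inpsi; rewrite scaleN1r addrC -T_factor => <-.
  have [inpsi1 inpsi2 _] := inpsi; have [inA1 inA2 _] := A_inLp_p (x k).
  set diff := fun t => -1 * A (x k) t + psi (q t) (x k).
  have diffE t : diff t = psi (q t) (x k) - A (x k) t by rewrite /diff mulN1r addrC.
  have mdiff : scalar_measurable diff.
    by rewrite (funext diffE); exact: scalar_measurableB.
  have diff_le : (Lp_norm mu p diff <= (eps + eps)%:E)%E.
    apply: Lp_norm_le_ae => //; first by rewrite addr_ge0// ltW.
    by apply: filterS (psi_near k) => t; rewrite diffE.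
  rewrite -lee_fin EFinM; apply: le_trans (B_bounded _) _.
    by have [? ?] := mdiff; split=> //; exact: le_lt_trans diff_le (ltry _).
  by apply: lee_wpmul2l => //; rewrite lee_fin.
have e0 : 0 <= b * (eps + eps) by rewrite mulr_ge0// addr_ge0// ltW.
have [v [vN vx]] := lift_factor_step (c := fun k i => psi i (x k))
  (y := fun k => T (x k)) e0 delta0 close.
have b'0 : 0 <= (b + delta) * (1 + delta) by rewrite mulr_ge0// addr_ge0// ltW.
have [T' [T'cont T'rank T'int T'norm T'E]] := atomic_operator b'0 psia vN.
exists T'; split=> // [|k].
  apply: le_trans T'norm _; rewrite lee_fin ler_wpM2l//.
  by have := mulr_ge0 (ltW delta0) (ltW delta0); nra.
rewrite T'E; apply: le_trans (vx k) _.
have := mulr_ge0 b_ge0 (ltW delta0); have := mulr_ge0 b_ge0 (ltW eps0).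
lra.
Qed.

End FiniteRankApproximation.

(** * The approximating net *)

Lemma inv_succ_lt (R : realType) (e : R) : 0 < e -> exists n : nat, n.+1%:R^-1 < e.
Proof.
move=> e0; exists (Num.truncn e^-1).
rewrite -[ltRHS]invrK ltf_pV2 ?posrE ?invr_gt0//.
have /Num.Theory.truncn_itv /andP[_ //] : 0 <= e^-1 by rewrite invr_ge0 ltW.
Qed.

Lemma inv_succ_le (R : realType) (m n : nat) : (m <= n)%N -> n.+1%:R^-1 <= m.+1%:R^-1 :> R.
Proof. by move=> mn; rewrite lef_pV2 ?posrE// ler_nat ltnS. Qed.

Lemma ltr_scalar_of_real (R : realType) (s : scalars) (r r' : R) :
  (scalar_of_real s r < scalar_of_real s r') = (r < r').
Proof. by rewrite !lt_def ler_scalar_of_real (inj_eq (@scalar_of_real_inj R s)). Qed.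

Lemma p_integral_approximation (R : realType) (s : scalars) (p : \bar R)
    (hp : (1%:E <= p)%E) (X Y : normedModType (scalar_field R s)) (T : X -> Y)
    (F : seq X) (e : R) : p_integral p T -> 0 < e ->
  exists T' : {linear X -> Y},
    [/\ continuous T', finite_rank T', p_integral p T',
        (p_integral_norm p T' <= p_integral_norm p T + e%:E)%E &
        forall x, x \in F -> rnorm (T' x - T x) <= e].
Proof.
move=> [d [S [mu [A [B fact]]]]] e0.
have fin : p_integral_norm p T \is a fin_num.
  rewrite ge0_fin_numE.
    apply: le_lt_trans (ltry (norm_into_Lp mu +oo A * norm_from_Lp mu p B)).
    by apply: ereal_inf_lbound; exists _, S, mu, A, B.
  apply/ereal_infP => _ [d' [S' [mu' [A' [B' [_ ->]]]]]].
  by rewrite lee_fin mulr_ge0 ?norm_into_Lp_ge0 ?norm_from_Lp_ge0.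
have e2 : 0 < e / 2 by rewrite divr_gt0.
have [_ [d' [S' [mu' [A' [B' [[mu1 A'b B'b TE] ->]]]]]] ab] := lb_ereal_inf_adherent e2 fin.
set a := norm_into_Lp _ _ _ in ab; set b := norm_from_Lp _ _ _ in ab.
have a0 : 0 <= a := norm_into_Lp_ge0 _ _ _.
have b0 : 0 <= b := norm_from_Lp_ge0 _ _ _.
have a1 : 0 < a + 1 by rewrite ltr_wpDl.
have [theta [theta0 theta1 theta2]] : exists theta : R,
    [/\ 0 < theta, theta <= e & theta * (a + 1) <= e / 2].
  exists (Num.min e (e / 2 / (a + 1))); split.
  - by rewrite lt_min e0 divr_gt0.
  - by rewrite ge_min lexx.
  - by rewrite -ler_pdivlMr// ge_min lexx orbT.
have [inA linA _] := A'b; have [linB _] := B'b.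
have [T' [T'1 T'2 T'3 T'4 T'5]] := finite_rank_approximation hp mu1 inA linA a0
  (norm_into_Lp_bound A'b) linB b0 (norm_from_Lp_bound B'b) TE (tnth (in_tuple F)) theta0.
exists T'; split=> // [|x xF].
  apply: le_trans T'4 _; rewrite mulrDr EFinD.
  have -> : (e%:E = (e / 2)%:E + (e / 2)%:E)%E by rewrite -EFinD -splitr.
  rewrite addeA; apply: leeD; first exact: ltW.
  by rewrite lee_fin; apply: le_trans theta2; rewrite mulrC ler_wpM2l ?(ltW theta0)// lerDl.
have [k ->] : exists k, x = tnth (in_tuple F) k by apply/tnthP.
exact: le_trans (T'5 k) theta1.
Qed.

(** The net is indexed by the finite sets of points at which to approximate,
    together with the inverse of the allowed error. *)
Theorem corollary4p3 (R : realType) (s : scalars) (p : \bar R)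
  (hp : (1%:E <= p)%E)
  (X : completeNormedModType (scalar_field R s)) :
  local_MAP (fun (X Y : completeNormedModType (scalar_field R s))
                 (T : X -> Y) => p_integral p T)
            (fun (X Y : completeNormedModType (scalar_field R s))
                 (T : X -> Y) => p_integral_norm p T) X.
Proof.
move=> Y T _ Tint.
have ex (i : seq X * nat) := p_integral_approximation hp i.1 Tint
  (ltac:(by rewrite invr_gt0 ltr0n) : 0 < i.2.+1%:R^-1 :> R).
have [T_ T_P] := choice ex.
pose le (i j : seq X * nat) := {subset i.1 <= j.1} /\ (i.2 <= j.2)%N.
exists (seq X * nat)%type, le, T_; split.
- split.
  + by constructor; exact: ([::], 0%N).
  + by move=> i; split.
  + by move=> i j k [ij1 ij2] [jk1 jk2]; split; [move=> x /ij1 /jk1|exact: leq_trans jk2].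
  + move=> i j; exists (i.1 ++ j.1, maxn i.2 j.2); split; split => /=.
    * by move=> x xi; rewrite mem_cat xi.
    * exact: leq_maxl.
    * by move=> x xj; rewrite mem_cat xj orbT.
    * exact: leq_maxr.
- by move=> i; have [] := T_P i.
- move=> x V /nbhs_ballP[r /= r0 rV].
  have rE : scalar_of_real s (scalar_re r) = r by rewrite scalar_reK// gtr0_real.
  have [n nr] : exists n : nat, n.+1%:R^-1 < scalar_re r.
    by apply: inv_succ_lt; rewrite -(ltr_scalar_of_real s) rE scalar_of_real0.
  exists ([:: x], n) => j [xj nj] /=; apply: rV.
  rewrite -ball_normE /ball_/= distrC -rnormE -rE ltr_scalar_of_real.
  have [_ _ _ _ /(_ x)] := T_P j; move=> /(_ (xj x (mem_head _ _))) /le_lt_trans; apply.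
  exact: le_lt_trans (inv_succ_le R nj) nr.
- apply/lee_addgt0Pr => e e0; have [n ne] := inv_succ_lt e0.
  apply: (@le_trans _ _ (ereal_sup [set p_integral_norm p (T_ j) | j in [set j | le ([::], n) j]])).
    by apply: ereal_inf_lbound; exists ([::], n).
  apply/ereal_supP => _ [j [_ nj] <-].
  have [_ _ _ Tj _] := T_P j; apply: le_trans Tj _; rewrite leeD2l// lee_fin.
  exact: le_trans (inv_succ_le R nj) (ltW ne).
Qed.
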